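(* Let $\Delta\ge 3$ be a fixed integer. For every graph $G_n$ on $n$ vertices with maximum degree $\Delta(G_n)\le \Delta$ and independence number $\alpha(G_n)\le \frac{n}{4}$, \[ R(P_n,G_n)=(\chi(G_n)-1)n+\sigma(G_n)+o(n)\qquad (n\to\infty), \] that is, for every $\delta>0$ there is $n_0=n_0(\Delta,\delta)$ such that for all $n\ge n_0$ and all such $G_n$ we have $\bigl|R(P_n,G_n)-\bigl((\chi(G_n)-1)n+\sigma(G_n)\bigr)\bigr|\le \delta n$.
   Context: $P_n$ denotes the path on $n$ vertices. For graphs $F,G$, the Ramsey number $R(F,G)$ is the smallest $N$ such that every red-blue edge-coloring of the complete graph $K_N$ contains a red copy of $F$ or a blue copy of $G$. $\chi(G)$ is the chromatic number of $G$, $\alpha(G)$ its independence number, and $\sigma(G)$ is the minimum size of a color class taken over all proper vertex-colorings of $G$ with exactly $\chi(G)$ colors. *)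

(* Defs.v *)
From mathcomp Require Import all_boot.

Set Implicit Arguments.
Unset Strict Implicit.
Unset Printing Implicit Defensive.

Record sgraph (T : finType) := SGraph {
  adj :> rel T;
  adj_sym : symmetric adj;
  adj_irrefl : irreflexive adj }.

Section Invariants.
Variables (T : finType) (G : sgraph T).

Definition max_degree : nat := \max_(x : T) #|[set y | G x y]|.

Definition independent (A : {set T}) : bool :=
  [forall x in A, forall y in A, ~~ G x y].

Definition independence_number : nat :=
  \max_(A : {set T} | independent A) #|A|.

Definition proper (k : nat) (f : {ffun T -> 'I_k}) : bool :=
  [forall x, forall y, G x y ==> (f x != f y)].

Definition colorable (k : nat) : bool :=
  [exists f : {ffun T -> 'I_k}, proper f].

Lemma colorable_ex : exists k, colorable k.
Proof.
exists #|T|; apply/existsP; exists [ffun x => enum_rank x].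
apply/forallP=> x; apply/forallP=> y; apply/implyP=> xy.
rewrite !ffunE; apply/negP=> /eqP/enum_rank_inj exy.
by move: xy; rewrite exy adj_irrefl.
Qed.

Definition chromatic_number : nat := ex_minn colorable_ex.

(* Every color class has at most #|T| elements, so the default value #|T| of
   the iterated minimum only matters when there is no color class at all, that
   is, for the graph without vertices. A proper coloring with values in
   'I_(chromatic_number) is surjective by minimality, so that all of its color
   classes are nonempty. *)
Definition min_color_class : nat :=
  \big[minn/#|T|]_(f : {ffun T -> 'I_chromatic_number} | proper f)
    \big[minn/#|T|]_(i < chromatic_number) #|[set x | f x == i]|.

End Invariants.

Definition path_rel (n : nat) : rel 'I_n :=
  fun i j => (i.+1 == j :> nat) || (j.+1 == i :> nat).

Lemma path_rel_sym n : symmetric (@path_rel n).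
Proof. by move=> i j; rewrite /path_rel orbC. Qed.

Lemma path_rel_irrefl n : irreflexive (@path_rel n).
Proof. by move=> i; rewrite /path_rel orbb gtn_eqF. Qed.

Definition path_graph (n : nat) : sgraph 'I_n :=
  SGraph (@path_rel_sym n) (@path_rel_irrefl n).

(* A red-blue coloring of the edges of the complete graph on 'I_N is a map
   c : {set 'I_N} -> bool, of which only the values on the pairs [set x; y]
   with x != y are used. The color true is red and false is blue. Copies are
   not required to be induced. *)
Definition mono_copy (N : nat) (c : {ffun {set 'I_N} -> bool}) (b : bool)
    (T : finType) (F : sgraph T) : bool :=
  [exists f : {ffun T -> 'I_N}, injectiveb f &&
    [forall x, forall y, F x y ==> (c [set f x; f y] == b)]].

Definition arrows (T U : finType) (F : sgraph T) (G : sgraph U) (N : nat) :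
    bool :=
  [forall c : {ffun {set 'I_N} -> bool},
    mono_copy c true F || mono_copy c false G].

Definition mono_clique (V : finType) (c : {set V} -> bool) (b : bool)
    (B : {set V}) : Prop :=
  forall x y, x \in B -> y \in B -> x != y -> c [set x; y] = b.

Lemma mono_cliqueU1 (V : finType) (c : {set V} -> bool) b x (B A : {set V}) :
  mono_clique c b B -> B \subset [set y in A :\ x | c [set x; y] == b] ->
  x \in A ->
  [/\ x |: B \subset A, #|x |: B| = #|B|.+1 & mono_clique c b (x |: B)].
Proof.
move=> cB /subsetP sB xA.
have sBP y : y \in B -> [/\ y != x, y \in A & c [set x; y] = b].
  by move/sB; rewrite !inE => /andP[/andP[-> ->] /eqP].
split.
- by apply/subsetP=> y; rewrite !inE => /orP[/eqP->|/sBP[]].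
- rewrite cardsU1; case: (boolP (x \in B)) => // /sBP[].
  by rewrite eqxx.
- move=> y z; rewrite !inE => /orP[/eqP->|yB] /orP[/eqP->|zB].
  + by rewrite eqxx.
  + by case: (sBP _ zB).
  + by rewrite setUC; case: (sBP _ yB).
  + exact: cB.
Qed.

Lemma ramsey_cliques (p q : nat) : exists N, forall (V : finType)
    (c : {set V} -> bool) (A : {set V}), N <= #|A| ->
  (exists B : {set V}, [/\ B \subset A, #|B| = p & mono_clique c true B]) \/
  (exists B : {set V}, [/\ B \subset A, #|B| = q & mono_clique c false B]).
Proof.
have clq0 (V : finType) (c : {set V} -> bool) b (A : {set V}) :
    exists B : {set V}, [/\ B \subset A, #|B| = 0 & mono_clique c b B].
  by exists set0; rewrite sub0set cards0; split=> // x y; rewrite inE.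
elim: p q => [|p IHp] q; first by exists 0 => V c A _; left; apply: clq0.
elim: q => [|q [N2 IHq]]; first by exists 0 => V c A _; right; apply: clq0.
have [N1 {}IHp] := IHp q.+1.
exists (N1 + N2).+1 => V c A leA.
have /card_gt0P[x xA] : 0 < #|A| by apply: leq_trans leA.
pose S b := [set y in A :\ x | c [set x; y] == b].
have SA b : S b \subset A by apply/subsetP=> y; rewrite !inE => /andP[/andP[]].
have leS : N1 + N2 <= #|S true| + #|S false|.
  move: leA; rewrite (cardsD1 x A) xA add1n ltnS => /leq_trans; apply.
  rewrite -(cardsID [set y | c [set x; y]] (A :\ x)) leq_add//.
    by apply/subset_leq_card/subsetP=> y; rewrite !inE eqb_id.
  apply/subset_leq_card/subsetP=> y; rewrite !inE eqbF_neg.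
  by case/andP=> -> ->.
case: (leqP N1 #|S true|) => [le1|lt1].
  case: (IHp V c _ le1) => -[B [sB cardB cB]]; [left|right].
    have [? cB1 ?] := mono_cliqueU1 cB sB xA.
    by exists (x |: B); rewrite cB1 cardB.
  by exists B; split=> //; apply: subset_trans (SA true).
have le2 : N2 <= #|S false|.
  by rewrite -(leq_add2l N1); apply: leq_trans leS _; rewrite leq_add2r ltnW.
case: (IHq V c _ le2) => -[B [sB cardB cB]]; [left|right].
  by exists B; split=> //; apply: subset_trans (SA false).
have [? cB1 ?] := mono_cliqueU1 cB sB xA.
by exists (x |: B); rewrite cB1 cardB.
Qed.

Lemma mono_clique_copy N (c : {ffun {set 'I_N} -> bool}) b (T : finType)
    (F : sgraph T) (B : {set 'I_N}) :
  #|B| = #|T| -> mono_clique c b B -> mono_copy c b F.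
Proof.
move=> cardB cB.
pose f (x : T) : 'I_N := enum_val (cast_ord (esym cardB) (enum_rank x)).
have f_inj : injective f.
  by move=> x y /enum_val_inj /cast_ord_inj /enum_rank_inj.
apply/existsP; exists [ffun x => f x]; apply/andP; split.
  by apply/injectiveP=> x y; rewrite !ffunE => /f_inj.
apply/forallP=> x; apply/forallP=> y; apply/implyP=> xy.
rewrite ![[ffun x => f x] _]ffunE; apply/eqP/cB; rewrite ?enum_valP//.
by apply/eqP=> /f_inj exy; move: xy; rewrite exy adj_irrefl.
Qed.

Lemma arrows_ex (T U : finType) (F : sgraph T) (G : sgraph U) :
  exists N, arrows F G N.
Proof.
have [N HN] := ramsey_cliques #|T| #|U|.
exists N; apply/forallP=> c; apply/orP.
case: (HN _ c [set: 'I_N]); rewrite ?cardsT ?card_ord// => -[B [_ cardB cB]].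
  by left; apply: mono_clique_copy cB.
by right; apply: mono_clique_copy cB.
Qed.

Definition ramsey (T U : finType) (F : sgraph T) (G : sgraph U) : nat :=
  ex_minn (arrows_ex F G).

(* Main.v *)
Require Import Defs.
From mathcomp Require Import all_boot all_order all_algebra reals.
From mathcomp Require Import perm zify.

(** Lower bound: take [chi - 1] disjoint red cliques of order [n - 1] and one of
    order [sigma - 1], all other edges being blue.

    Upper bound: let the red graph on [(chi - 1) n + sigma + n / q] vertices
    have no path on [n] vertices.  A one-sided regularity lemma cuts almost all
    vertices into boundedly many clusters of equal size such that almost all
    pairs of clusters are either without red edges or hole-free, that is, red
    edges join any two subsets of a fixed proportion; the potential is simply
    the number of vertex pairs lying in pairs of clusters without red edges.
    By depth-first search a hole-free pair carries a red path through almost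
    all of its vertices, and such paths can be linked inside a component of
    the reduced graph.  Hall's theorem with deficiency in a component [C] with
    more than [n] vertices therefore gives a set [I] of clusters, independent
    in the reduced graph and with neighbourhood [S], such that
    [|C| - |I| + |S|] clusters have about [n] vertices at most.  Each
    [W = C \ I \ S] and each single vertex of [I] forms a block, and the edges
    between different blocks are blue up to few at every vertex.  Counting
    shows that the blocks can be shared out to the colour classes of an
    optimal colouring of [G], all of size at most [n / 4], so that every class
    fits, with room to spare, into its share; [G] is then embedded in blue
    greedily. *)

Set Implicit Arguments.
Unset Strict Implicit.
Unset Printing Implicit Defensive.

(** * One-sided regularity *)

Lemma subset_of_card (T : finType) (A : {set T}) (l : nat) :
  l <= #|A| -> exists2 B : {set T}, B \subset A & #|B| = l.
Proof.
case/card_geqP=> s [us <- sA]; exists [set x in s].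
  by apply/subsetP=> x; rewrite inE => /sA.
by rewrite cardsE (card_uniqP us).
Qed.

(** As long as some fibre of [s] keeps [l] elements, [l] of them are cut off; when this stops, each
    of the at most [#|F|] fibres has fewer than [l] elements left. *)
Lemma chop (T S : finType) (s : T -> S) (F : {set S}) (l : nat) (U : {set T}) :
  0 < l -> (forall x, x \in U -> s x \in F) ->
  exists P : {set {set T}},
    [/\ trivIset P,
        forall A, A \in P ->
          [/\ A \subset U, #|A| = l & {in A &, forall x y, s x = s y}]
      & #|U :\: cover P| <= #|F| * l].
Proof.
move=> l0; have [m] := ubnP #|U|; elim: m U => // m IH U /ltnSE leU UF.
case: (boolP [exists f, l <= #|[set x in U | s x == f]|]) => [/existsP[f lef]|].
  have [A sA cA] := subset_of_card lef.
  have AU : A \subset U.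
    by apply: subset_trans sA _; apply/subsetP=> x; rewrite inE => /andP[].
  have ltm : #|U :\: A| < m.
    by have := subset_leq_card AU; rewrite cardsD (setIidPr AU); lia.
  have [|P [tP HP cP]] := IH _ ltm.
    by move=> x; rewrite inE => /andP[_ /UF].
  have [tP' _] : trivIset (A |: P) /\ A \notin P.
    apply: trivIsetU1 => //.
    - move=> B /HP[sB _ _]; rewrite disjoint_sym disjoints_subset.
      by apply: subset_trans sB _; rewrite setDE subsetIr.
    - by apply/negP => /HP[_]; rewrite cards0; lia.
  exists (A |: P); split=> //.
  - move=> B; rewrite inE => /orP[|/HP[sB cB sBs]].
      rewrite inE => /eqP->; split=> // x y /(subsetP sA).
      rewrite inE => /andP[_ /eqP->] /(subsetP sA).
      by rewrite inE => /andP[_ /eqP->].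
    by split=> //; apply: subset_trans sB _; apply: subsetDl.
  - by rewrite /cover bigcup_setU big_set1 -setDDl.
move=> /existsPn small.
exists set0; split; first by apply/trivIsetP=> A; rewrite inE.
  by move=> A; rewrite inE.
rewrite /cover big_set0 setD0 -sum1_card (partition_big s (mem F)) //=.
rewrite -sum_nat_const; apply: leq_sum => f _.
have := small f; rewrite -ltnNge sum1_card => /ltnW; apply: leq_trans.
by apply: subset_leq_card; apply/subsetP=> x; rewrite !inE.
Qed.

Definition no_edges (V : finType) (r : rel V) (X Y : {set V}) : bool :=
  [forall x in X, forall y in Y, ~~ r x y].

Lemma no_edgesP (V : finType) (r : rel V) (X Y : {set V}) :
  reflect {in X & Y, forall x y, ~~ r x y} (no_edges r X Y).
Proof.
apply: (iffP forall_inP) => H x.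
  by move=> y /H /forall_inP/[apply].
by move=> xX; apply/forall_inP=> y; apply: H.
Qed.

Definition is_hole (V : finType) (r : rel V) (h : nat) (A B : {set V})
    (XY : {set V} * {set V}) : bool :=
  [&& XY.1 \subset A, XY.2 \subset B, h <= #|XY.1|, h <= #|XY.2|
    & no_edges r XY.1 XY.2].

Definition has_hole (V : finType) (r : rel V) (h : nat) (A B : {set V}) :=
  [exists XY, is_hole r h A B XY].

(** The pairs on which a refinement gains: the hole yields vertex pairs without red edges, while the
    pair as a whole is not yet counted as such. *)
Definition bad_pair (V : finType) (r : rel V) (h : nat) (A B : {set V}) :=
  has_hole r h A B && ~~ no_edges r A B.

Definition bad_pairs (V : finType) (r : rel V) (h : nat) (P : {set {set V}}) :=
  [set AB in setX P P | bad_pair r h AB.1 AB.2].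

(** The potential of the regularity argument, at most [#|V| ^ 2]. *)
Definition dead_pairs (V : finType) (r : rel V) (P : {set {set V}}) :=
  [set uv : V * V | [exists A in P, exists B in P,
     [&& uv.1 \in A, uv.2 \in B & no_edges r A B]]].

Lemma dead_pairsP (V : finType) (r : rel V) (P : {set {set V}}) uv :
  reflect (exists A B, [/\ A \in P, B \in P, uv.1 \in A, uv.2 \in B
             & no_edges r A B])
          (uv \in dead_pairs r P).
Proof.
rewrite /dead_pairs in_set; apply: (iffP exists_inP) => [[A AP]|].
  by case/exists_inP=> B BP /and3P[uA vB nAB]; exists A, B.
case=> A [B [AP BP uA vB nAB]]; exists A => //.
by apply/exists_inP; exists B => //; rewrite uA vB.
Qed.

Section Refinement.
Variables (V : finType) (r : rel V) (P : {set {set V}}) (l h : nat).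
Hypothesis trivP : trivIset P.
Hypothesis cardP : forall A, A \in P -> #|A| = l.

Lemma trivIset_eq (A B : {set V}) x :
  A \in P -> B \in P -> x \in A -> x \in B -> A = B.
Proof.
move=> AP BP xA xB; apply/eqP; apply: contraTT xB => neAB.
by have /trivIsetP/(_ A B AP BP neAB)/disjointFr-> := trivP.
Qed.

Lemma card_cover_eq : #|cover P| = l * #|P|.
Proof.
have [_] := leq_card_cover P; rewrite trivP => /eqP->.
by rewrite (eq_bigr (fun=> l)) // sum_nat_const mulnC.
Qed.

Let wit (AB : {set V} * {set V}) : {set V} * {set V} :=
  odflt (set0, set0) [pick XY | is_hole r h AB.1 AB.2 XY].

Let witP AB : AB \in bad_pairs r h P -> is_hole r h AB.1 AB.2 (wit AB).
Proof.
rewrite inE => /andP[_ /andP[/existsP[XY hXY] _]].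
by rewrite /wit; case: pickP => //= /(_ XY); rewrite hXY.
Qed.

Let wit_sub AB : (wit AB).1 \subset AB.1 /\ (wit AB).2 \subset AB.2.
Proof.
rewrite /wit; case: pickP => [XY /and3P[]//|_]; by rewrite !sub0set.
Qed.

(** The clusters together with both sides of a hole of every pair that has one; the next partition
    refines the atoms of this family. *)
Let wits := P :|: ((fun AB => (wit AB).1) @: setX P P)
              :|: ((fun AB => (wit AB).2) @: setX P P).

Let card_wits : #|wits| <= #|P| + 2 * #|P| ^ 2.
Proof.
have le1 (f : {set V} * {set V} -> {set V}) : #|f @: setX P P| <= #|P| ^ 2.
  by apply: leq_trans (leq_imset_card _ _) _; rewrite cardsX.
apply: leq_trans (leq_card_setU _ _) _; rewrite mul2n -addnn addnA leq_add //.
by apply: leq_trans (leq_card_setU _ _) _; rewrite leq_add.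
Qed.

(** The atoms of [wits] are cut into pieces of size [m]. A piece lies inside every set of [wits]
    that it meets, so dead pairs stay dead and each bad pair adds the at least [h ^ 2] vertex pairs
    of its hole, apart from pairs with a coordinate among the vertices left over by the cutting. *)
Lemma refine_dead_pairs (K m : nat) :
  #|P| <= K -> 0 < m ->
  exists P' : {set {set V}},
    [/\ trivIset P', forall A, A \in P' -> #|A| = m,
      #|cover P| <= #|cover P'| + 2 ^ (K + 2 * K ^ 2) * m
    & #|dead_pairs r P| + h ^ 2 * #|bad_pairs r h P| <=
      #|dead_pairs r P'| + 2 * (2 ^ (K + 2 * K ^ 2) * m) * #|V|].
Proof.
(* [s v] encodes the atom of [v] by its trace on [wits]; there are at most [2 ^ #|wits|] atoms. *)
move=> leK m0; pose s v := [set F in wits | v \in F].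
have sF v : v \in cover P -> s v \in powerset wits.
  by move=> _; rewrite inE; apply/subsetP=> F; rewrite inE => /andP[].
have [P' [tP' HP' cP']] := chop m0 sF.
set R := cover P :\: cover P' in cP'.
have leR : #|R| <= 2 ^ (K + 2 * K ^ 2) * m.
  apply: leq_trans cP' _; rewrite leq_mul2r card_powerset leq_exp2l //.
  rewrite (leq_trans card_wits) ?orbT // leq_add ?leq_mul2l ?leq_exp2r //.
have subF A F x : A \in P' -> F \in wits -> x \in A -> x \in F -> A \subset F.
  move=> AP' Fw xA xF; apply/subsetP=> y yA.
  have [_ _ /(_ _ _ xA yA) exy] := HP' _ AP'.
  have : F \in s x by rewrite inE Fw.
  by rewrite exy inE => /andP[].
exists P'; split=> // [A /HP'[]//||].
  rewrite -(cardsID (cover P')) leq_add //.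
  by apply: subset_leq_card; rewrite subsetIr.
pose Q (AB : {set V} * {set V}) : {set V * V} :=
  if AB \in bad_pairs r h P then setX (wit AB).1 (wit AB).2 else set0.
have QP AB uv : uv \in Q AB ->
    [/\ AB \in bad_pairs r h P, uv.1 \in (wit AB).1 & uv.2 \in (wit AB).2].
  rewrite /Q; case: ifP => // _; rewrite ?inE //.
  by case/andP.
have QPAB AB uv : uv \in Q AB ->
    [/\ AB.1 \in P, AB.2 \in P, uv.1 \in AB.1 & uv.2 \in AB.2].
  case/QP=> bAB u1 u2; have /and5P[/subsetP s1 /subsetP s2 _ _ _] := witP bAB.
  by move: bAB; rewrite !inE => /andP[/andP[-> ->] _]; rewrite s1 ?s2.
have disjQ AB CD : AB != CD -> [disjoint Q AB & Q CD].
  apply: contraNT => /pred0Pn[uv /andP[/QPAB[A1 A2 u1 u2] /QPAB[B1 B2 v1 v2]]].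
  rewrite [AB]surjective_pairing [CD]surjective_pairing.
  by rewrite (trivIset_eq A1 B1 u1 v1) (trivIset_eq A2 B2 u2 v2).
have cardQ : h ^ 2 * #|bad_pairs r h P| <= #|\bigcup_AB Q AB|.
  rewrite -[leqRHS]sum1_card (partition_disjoint_bigcup _ _ disjQ).
  rewrite mulnC -sum_nat_const.
  rewrite [leqRHS](bigID (mem (bad_pairs r h P))) /= -[leqLHS]addn0.
  apply: leq_add => //; apply: leq_sum => AB bAB.
  rewrite sum1_card /Q bAB cardsX.
  by have /and5P[_ _ h1 h2 _] := witP bAB; rewrite leq_mul.
(* A bad pair is not free of red edges, so none of the gained vertex pairs was dead before. *)
have disjZ : [disjoint dead_pairs r P & \bigcup_AB Q AB].
  apply/pred0P=> uv; apply/negP=> /andP[/=].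
  case/dead_pairsP=> A [B [AP BP uA vB zAB]].
  case/bigcupP=> AB _ uvQ; have [A1 A2 u1 u2] := QPAB _ _ uvQ.
  have [] := QP _ _ uvQ; rewrite inE => /andP[_ /andP[_ /negP[]]].
  by rewrite -(trivIset_eq AP A1 uA u1) -(trivIset_eq BP A2 vB u2).
apply: leq_trans (leq_add (leqnn _) cardQ) _.
rewrite -cardsUI (disjoint_setI0 disjZ) cards0 addn0.
(* The lost pairs have a coordinate in [R], so there are at most [2 * #|R| * #|V|] of them. *)
have : dead_pairs r P :|: \bigcup_AB Q AB \subset
    dead_pairs r P' :|: (setX R setT :|: setX setT R).
  apply/subsetP=> -[u v] uvQ; rewrite !in_setU !in_setX !in_setT andbT.
  have [|uR] := boolP (u \in R); first by rewrite orbT.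
  have [|vR] := boolP (v \in R); first by rewrite !orbT.
  rewrite orbF; have [A [B [AP BP uA vB nAB]]] :
    exists A, exists B, [/\ A \in wits, B \in wits, u \in A, v \in B
      & no_edges r A B].
    move: uvQ; rewrite inE => /orP[|/bigcupP[AB _ uvQ]].
      case/dead_pairsP=> A [B [AP BP uA vB zAB]].
      by exists A, B; rewrite !inE AP BP.
    have [bAB u1 u2] := QP _ _ uvQ; exists (wit AB).1, (wit AB).2.
    have /and5P[_ _ _ _ ->] := witP bAB; split=> //; rewrite !inE.
      rewrite [X in _ || X || _]imset_f ?orbT //.
      by move: bAB; rewrite inE => /andP[].
    by rewrite [X in _ || X]imset_f ?orbT //; move: bAB; rewrite inE => /andP[].
  have inP F w : F \in wits -> w \in F -> w \in cover P.
    rewrite !inE => /orP[/orP[FP wF|/imsetP[AB AB2 ->]]|/imsetP[AB AB2 ->]].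
    - by apply/bigcupP; exists F.
    - move: AB2; rewrite inE => /andP[AB1 _] /(subsetP (proj1 (wit_sub AB))) wA.
      by apply/bigcupP; exists AB.1.
    - move: AB2; rewrite inE => /andP[_ AB2] /(subsetP (proj2 (wit_sub AB))) wA.
      by apply/bigcupP; exists AB.2.
  have {}inP F w : F \in wits -> w \in F -> w \notin R ->
      exists C, [/\ C \in P', w \in C & C \subset F].
    move=> Fw wF; rewrite !inE negb_and negbK (inP F) // orbF.
    by case/bigcupP=> C CP' wC; exists C; split=> //; apply: subF Fw wC wF.
  have [C [CP uC /subsetP sC]] := inP A u AP uA uR.
  have [D [DP vD /subsetP sD]] := inP B v BP vB vR.
  apply/dead_pairsP; exists C, D; split=> //.
  apply/no_edgesP => x y /sC xA /sD yB.
  by move/no_edgesP: nAB; apply.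
move/subset_leq_card/leq_trans; apply; apply: leq_trans (leq_card_setU _ _) _.
rewrite leq_add2l; apply: leq_trans (leq_card_setU _ _) _.
rewrite !cardsX cardsT; have := leq_mul leR (leqnn #|V|).
by move: (_ * m) => X; nia.
Qed.
End Refinement.

Definition regular_partition (V : finType) (r : rel V) (g q K l : nat)
    (P : {set {set V}}) : Prop :=
  [/\ trivIset P, forall A, A \in P -> #|A| = l, 0 < #|P| <= K,
      q * #|V| <= q * #|cover P| + #|V|
    & q * #|bad_pairs r (l %/ g) P| <= #|P| ^ 2].

Lemma double_divn (g l : nat) : 0 < g <= l -> l <= 2 * g * (l %/ g).
Proof.
case/andP=> g0 gl; have := divn_eq l g; have := ltn_pmod l g0.
have : 0 < l %/ g by rewrite divn_gt0.
by nia.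
Qed.

(** When [p] clusters of size [l] cover at least half of the [n] vertices and holes have size [h] at
    least [l / (2 g)], more than [p ^ 2 / q] bad pairs gain a share [1 / (16 g ^ 2 q)] of all vertex
    pairs. *)
Lemma arith_hole_gain n l p g h q b :
  n <= 2 * (l * p) -> l <= 2 * g * h -> p ^ 2 < q * b ->
  n ^ 2 <= 16 * g ^ 2 * q * (h ^ 2 * b).
Proof.
move=> nlp lgh /ltnW pq.
have : n ^ 2 <= (2 * (l * p)) ^ 2 by rewrite leq_sqr.
move/leq_trans; apply.
have := leq_mul (leq_mul lgh lgh) pq.
rewrite !expnMn => H; apply: leq_trans (_ : 4 * (l * l * p ^ 2) <= _).
  by rewrite !mulnn mulnA.
have -> : 16 * g ^ 2 * q * (h ^ 2 * b) =
    4 * (2 * g * h * (2 * g * h) * (q * b)) by lia.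
by rewrite leq_mul2l H.
Qed.

Lemma arith_divisor c xi Q m n :
  c <= xi -> m * (xi * Q) <= n -> c * (Q * m) <= n.
Proof. by move=> cx; apply: leq_trans; rewrite [m * _]mulnC -mulnA leq_mul. Qed.

Lemma arith_potential c0 t n d d' hb Qm :
  t * n ^ 2 <= 2 * c0 * d -> n ^ 2 <= c0 * hb ->
  d + hb <= d' + 2 * Qm * n -> 4 * c0 * Qm <= n -> t.+1 * n ^ 2 <= 2 * c0 * d'.
Proof.
move=> H1 H2 H3 /(leq_mul (leqnn n)) H4.
have := leq_mul (leqnn (2 * c0)) H3; lia.
Qed.

Lemma arith_loss q T t n c :
  0 < T -> t <= T -> 4 * q * T * n <= 4 * q * T * c + t * n ->
  4 * q * n <= 4 * q * c + n.
Proof.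
move=> T0 tT H; rewrite -(leq_pmul2r T0).
have := leq_mul tT (leqnn n); lia.
Qed.
Lemma arith_half q n c : 0 < q -> 4 * q * n <= 4 * q * c + n -> n <= 2 * c.
Proof. nia. Qed.

(** Increment argument: as long as too many pairs are bad, a refinement raises the number of dead
    pairs by at least [#|V| ^ 2 / (2 * c0)], which can happen at most [2 * c0] times. *)
Lemma hole_regularity (g q : nat) : 0 < g -> 0 < q ->
  exists K N0, forall (V : finType) (r : rel V), N0 <= #|V| ->
    exists P l, regular_partition r g q K l P.
Proof.
(* A refinement gains [#|V| ^ 2 / c0] and loses at most half of that through leftover vertices. [T]
   rounds that lose at most [#|V| / xi] vertices each leave at most [#|V| / (4 * q)] vertices
   uncovered. *)
move=> g0 q0; pose c0 := 16 * g ^ 2 * q.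
pose T := 2 * c0 + 1; pose xi := 4 * q * T.
have c00 : 16 <= c0 by rewrite /c0 -mulnA leq_pmulr // muln_gt0 expn_gt0 g0.
have T0 : 0 < T by rewrite /T addn1.
have xi0 : 4 * c0 <= xi.
  by rewrite /xi -mulnA leq_mul2l /= (leq_trans _ (leq_pmull _ q0)) // /T; lia.
(* After [t] rounds either a regular partition has been found or a share [t / (2 * c0)] of all
   vertex pairs is dead; for [t = T] the second is impossible. *)
suff H t : t <= T -> exists K N0, 0 < N0 /\ forall (V : finType) (r : rel V),
    N0 <= #|V| ->
    (exists P l, regular_partition r g q K l P) \/
    (exists P l, [/\ trivIset P, forall A, A \in P -> #|A| = l, 0 < #|P| <= K,
      xi * #|V| <= xi * #|cover P| + t * #|V|
    & t * #|V| ^ 2 <= 2 * c0 * #|dead_pairs r P|]).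
  have [K [N0 [N00 HN]]] := H T (leqnn T); exists K, N0 => V r leV.
  case: (HN V r leV) => // -[P [l [_ _ _ _]]].
  have : #|dead_pairs r P| <= #|V| ^ 2.
    by apply: leq_trans (max_card _) _; rewrite card_prod.
  have : 0 < #|V| ^ 2 by rewrite expn_gt0 (leq_trans N00 leV).
  rewrite /T => V2 led /leq_trans/(_ (leq_mul (leqnn _) led)).
  by rewrite leq_pmul2r // addn1 ltnn.
elim: t => [_|t IH ltT].
  exists 1, 1; split=> // V r V0; right; exists [set setT], #|V|.
  rewrite cards1 !mul0n addn0 /cover big_set1 cardsT; split=> //.
    by apply/trivIsetP=> A B; rewrite !inE => /eqP-> /eqP->; rewrite eqxx.
  by move=> A; rewrite inE => /eqP->; rewrite cardsT.
have [K [N0 [N00 HN]]] := IH (ltnW ltT).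
pose Q := 2 ^ (K + 2 * K ^ 2).
have Q0 : 0 < Q by rewrite expn_gt0.
have xiQ0 : 0 < xi * Q by rewrite muln_gt0 Q0 andbT; lia.
(* At least [xi * Q] vertices make the new cluster size positive, and then there are at most
   [2 * xi * Q] new clusters; [2 * K * g] gives [g <= l], so that rounding in [l %/ g] costs at most
   a factor 2. *)
exists (maxn K (2 * xi * Q)), (maxn N0 (maxn (xi * Q) (2 * K * g))).
split; first by lia.
move=> V r leV; have leV0 : N0 <= #|V| by lia.
case: (HN V r leV0) => [[P [l [tP cP /andP[P0 PK] covP badP]]]|].
  by left; exists P, l; split=> //; clear -P0 PK covP; lia.
case=> P [l [tP cP /andP[P0 PK] inv1 inv2]].
have cov := card_cover_eq tP cP.
have V0 : 0 < #|V| by lia.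
have xiP : 4 * q * #|V| <= 4 * q * #|cover P| + #|V|.
  exact: arith_loss T0 (ltnW ltT) inv1.
have covV := arith_half q0 xiP.
have [good|ltbad] := leqP (q * #|bad_pairs r (l %/ g) P|) (#|P| ^ 2).
  by left; exists P, l; split=> //; lia.
right; have m0 : 0 < #|V| %/ (xi * Q) by rewrite divn_gt0; lia.
have [P' [tP' cP' covP' deadP']] := refine_dead_pairs r (l %/ g) tP PK m0.
exists P', (#|V| %/ (xi * Q)).
have mdiv : #|V| %/ (xi * Q) * (xi * Q) <= #|V| by apply: leq_divM.
have mdiv2 : #|V| <= 2 * (xi * Q) * (#|V| %/ (xi * Q)).
  by apply: double_divn; lia.
have cov' := card_cover_eq tP' cP'.
have covV' : #|cover P'| <= #|V| by apply: max_card.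
move: m0 mdiv mdiv2 cP' covP' deadP' cov'; rewrite -/Q.
move: (_ %/ (xi * Q)) => m m0 mdiv mdiv2 cP' covP' deadP' cov'.
have gl : g <= l.
  have K0 : 0 < K by apply: leq_trans PK.
  have : 2 * K * g <= 2 * (l * K).
    have: 2 * K * g <= #|V| by lia.
    by move/leq_trans; apply; rewrite (leq_trans covV) // cov !leq_mul.
  by rewrite -mulnA leq_pmul2l // mulnC leq_pmul2r.
have lh : l <= 2 * g * (l %/ g) by rewrite double_divn // g0.
have c0Q : 4 * c0 * (Q * m) <= #|V| := arith_divisor xi0 mdiv.
have xiQ : xi * (Q * m) <= #|V| := arith_divisor (leqnn xi) mdiv.
have hb : #|V| ^ 2 <= c0 * ((l %/ g) ^ 2 * #|bad_pairs r (l %/ g) P|).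
  by apply: arith_hole_gain lh ltbad; rewrite -cov.
split=> //.
- apply/andP; split.
    have : 16 * (Q * m) <= #|V|.
      by apply: leq_trans c0Q; rewrite leq_mul // (leq_trans c00) // leq_pmull.
    case: (posnP #|P'|) => // P'0; move: cov'.
    by rewrite P'0 muln0; clear -V0 covV covP'; lia.
  rewrite leq_max; apply/orP; right.
  rewrite -(leq_pmul2l m0) -cov' mulnC.
  by rewrite -(mulnA 2 xi Q) (leq_trans covV').
- have := leq_mul (leqnn xi) covP'; clear -inv1 xiQ; lia.
- exact: arith_potential inv2 hb deadP' c0Q.
Qed.

(** * Long red paths *)

Lemma alternating_count (T : Type) (a : pred T) (s : seq T) :
  sorted (fun u v => a u != a v) s -> 2 * count a s <= (size s).+1.
Proof.
case: s => // x p px.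
suff: 2 * count a (x :: p) <= size (x :: p) + a x.
  by move/leq_trans; apply; rewrite -addn1 leq_add2l leq_b1.
elim: p x px => [|y p IH] x /=; first by case: (a x).
by case/andP=> axy /IH /=; move: axy; case: (a x) (a y) => -[] //= _; lia.
Qed.

Lemma no_edges_sym (V : finType) (r : rel V) (X Y : {set V}) :
  symmetric r -> no_edges r X Y -> no_edges r Y X.
Proof.
by move=> rsym /no_edgesP nXY; apply/no_edgesP => x y xY yX; rewrite rsym nXY.
Qed.

(* Depth-first search: [s] is the stack, [F] the set of finished and [T] the
   set of unvisited vertices; every step changes [#|F| - #|T|] by one. *)
Lemma dfs_balanced (V : finType) (r : rel V) (U : {set V}) : symmetric r ->
  exists s (F T : {set V}),
    [/\ sorted r s, uniq s, #|F| = #|T|, no_edges r F T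
      & forall x, (x \in s) + (x \in F) + (x \in T) = (x \in U)].
Proof.
move=> rsym.
suff H k (s : seq V) (F T : {set V}) :
    [/\ sorted r s, uniq s, #|F| + k = #|T|, no_edges r F T
      & forall x, (x \in s) + (x \in F) + (x \in T) = (x \in U)] ->
    exists s (F T : {set V}),
    [/\ sorted r s, uniq s, #|F| = #|T|, no_edges r F T
      & forall x, (x \in s) + (x \in F) + (x \in T) = (x \in U)].
  apply: (H #|U| [::] set0 U); split; rewrite ?cards0 //.
    by apply/no_edgesP=> x y; rewrite inE.
  by move=> x; rewrite !inE.
elim: k s F T => [|k IH] s F T [ss us cFT nFT part].
  by exists s, F, T; split=> //; rewrite -cFT addn0.
have push y : y \in T -> sorted r (y :: s) -> exists s (F T : {set V}),
    [/\ sorted r s, uniq s, #|F| = #|T|, no_edges r F T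
      & forall x, (x \in s) + (x \in F) + (x \in T) = (x \in U)].
  move=> yT sy; apply: (IH (y :: s) F (T :\ y)); split=> //.
  - rewrite cons_uniq us andbT; apply/negP => ys; have := part y.
    by rewrite ys yT; case: (y \in U) (y \in F) => -[].
  - by have := cardsD1 y T; rewrite yT; lia.
  - move/no_edgesP: nFT => nFT; apply/no_edgesP=> x z xF.
    by rewrite inE => /andP[_ /(nFT _ _ xF)].
  - move=> x; have := part x; rewrite !inE; case: eqP => [->|] //=.
    by rewrite yT; case: (y \in U) (y \in F) (y \in s) => -[] [].
case: s ss us part push => [|x s] ss us part push.
  have /card_gt0P[y yT] : 0 < #|T| by lia.
  exact: push yT _.
have [/exists_inP[y yT rxy]|/exists_inPn nxT] := boolP [exists y in T, r x y].
  by apply: push yT _; rewrite /= rsym rxy.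
move: us; rewrite cons_uniq => /andP[xs us].
have xF : x \notin F.
  apply/negP=> xF; have := part x; rewrite in_cons eqxx xF.
  by case: (x \in U) (x \in T) => -[].
apply: (IH s (x |: F) T); split=> //.
- exact: path_sorted ss.
- by rewrite cardsU1 xF; lia.
- move/no_edgesP: nFT => nFT; apply/no_edgesP=> z y.
  by rewrite inE => /orP[|/nFT]; [rewrite inE => /eqP-> /nxT | apply].
- move=> z; have := part z; rewrite !inE; case: eqP => [->|] //=.
  by rewrite (negPf xs) (negPf xF).
Qed.

(** Depth-first search in the bipartite graph between [X] and [Y] is stopped when [F] and [T] have
    equal size. Hole-freeness makes one of [F :&: X], [T :&: Y] and one of [T :&: X], [F :&: Y]
    smaller than [h]; as the stack alternates between the sides, every combination leaves at most
    [4 * h] vertices off the stack. *)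
Lemma alternating_path (V : finType) (r : rel V) (X Y : {set V}) (h : nat) :
  symmetric r -> 0 < h -> [disjoint X & Y] -> #|X| = #|Y| ->
  ~~ has_hole r h X Y ->
  exists s, [/\ sorted (fun u v => r u v && ((u \in X) != (v \in X))) s, uniq s,
    {subset s <= X :|: Y} & 2 * #|X| <= size s + 4 * h].
Proof.
move=> rsym h0 dXY cXY nohole.
pose rb : rel V := fun u v => r u v && ((u \in X) != (v \in X)).
have rbsym : symmetric rb by move=> u v; rewrite /rb rsym eq_sym.
have [s [F [T [ss us cFT nFT part]]]] := dfs_balanced (X :|: Y) rbsym.
have sU : {subset s <= X :|: Y}.
  by move=> x xs; have := part x; rewrite xs; case: (x \in X :|: Y).
exists s; split=> //.
have cnt (A : {set V}) : A \subset X :|: Y ->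
    count (mem A) s + #|F :&: A| + #|T :&: A| = #|A|.
  move=> /subsetP AU.
  have card_sum (B : {set V}) : #|B :&: A| = \sum_(x in A) (x \in B).
    rewrite -sum1_card big_mkcond [RHS]big_mkcond; apply: eq_bigr => x _.
    by rewrite inE andbC; case: (x \in A); case: (x \in B).
  have -> : count (mem A) s = #|[set x in s] :&: A|.
    rewrite -size_filter -(card_uniqP (filter_uniq _ us)).
    by apply: eq_card => x; rewrite !inE mem_filter andbC.
  rewrite !card_sum -!big_split -sum1_card; apply: eq_bigr => x /AU xU /=.
  by rewrite inE part xU.
have := cnt X (subsetUl X Y); have := cnt Y (subsetUr X Y).
have sX : 2 * count (mem X) s <= (size s).+1.
  by apply/alternating_count/(sub_sorted _ ss) => u v /andP[].
have nX w : predC (mem X) w = (w \notin X) by [].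
have sY : 2 * count (predC (mem X)) s <= (size s).+1.
  apply/alternating_count/(sub_sorted _ ss) => u v /andP[_].
  by rewrite (nX u) (nX v); case: (u \in X) (v \in X) => -[].
have YX : count (mem Y) s = count (predC (mem X)) s.
  apply/eq_in_count => x /sU; rewrite inE (nX x) -[mem Y x]/(x \in Y).
  have := disjoint_setI0 dXY => /setP/(_ x); rewrite !inE.
  by case: (x \in X) (x \in Y) => -[].
have := count_predC (mem X) s.
have FU (B : {set V}) : B \subset X :|: Y -> #|B| = #|B :&: X| + #|B :&: Y|.
  move=> /setIidPl {1}<-; rewrite setIUr cardsU setIACA setIid.
  by rewrite (disjoint_setI0 dXY) setI0 cards0 subn0.
have cF : #|F| = #|F :&: X| + #|F :&: Y|.
  apply: FU; apply/subsetP=> x xF; have := part x; rewrite xF addn1.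
  by case: (x \in X :|: Y).
have cT : #|T| = #|T :&: X| + #|T :&: Y|.
  apply: FU; apply/subsetP=> x xT; have := part x; rewrite xT addn1.
  by case: (x \in X :|: Y).
have nh (A B : {set V}) : A \subset X -> B \subset Y -> 
    no_edges rb A B || no_edges rb B A -> (#|A| < h) || (#|B| < h).
  move=> AX BY nAB; rewrite !ltnNge -negb_and; apply: contra nohole.
  case/andP=> hA hB; apply/existsP; exists (A, B).
  rewrite /is_hole /= AX BY hA hB /=.
  have {}nAB : no_edges rb A B.
    by case/orP: nAB => //; apply: no_edges_sym.
  apply/no_edgesP => x y xA yB; move/no_edgesP/(_ x y xA yB): nAB.
  rewrite /rb (subsetP AX) // (disjointFl dXY (subsetP BY _ yB)).
  by rewrite andbT.
have no_sub (A B A' B' : {set V}) :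
    no_edges rb A B -> no_edges rb (A :&: A') (B :&: B').
  move/no_edgesP=> nAB; apply/no_edgesP=> x y.
  by rewrite !inE => /andP[xA _] /andP[yB _]; apply: nAB.
have h1 : (#|F :&: X| < h) || (#|T :&: Y| < h).
  by apply: nh; rewrite ?subsetIr // no_sub.
have h2 : (#|T :&: X| < h) || (#|F :&: Y| < h).
  by apply: nh; rewrite ?subsetIr // (no_sub F) // orbT.
by move: (count _ s) (count _ s) sX sY YX h1 h2 cFT cF cT cXY h0; clear; lia.
Qed.

Lemma no_holeP (V : finType) (r : rel V) (h : nat) (A B X Y : {set V}) :
  ~~ has_hole r h A B -> X \subset A -> Y \subset B -> h <= #|X| -> h <= #|Y| ->
  exists x y, [/\ x \in X, y \in Y & r x y].
Proof.
move=> /existsPn/(_ (X, Y)); rewrite /is_hole /= => nh XA YB hX hY.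
move: nh; rewrite XA YB hX hY /= => /forall_inPn[x xX /forall_inPn[y yY]].
by rewrite negbK => rxy; exists x, y.
Qed.

Lemma has_hole_sym (V : finType) (r : rel V) (h : nat) (A B : {set V}) :
  symmetric r -> has_hole r h A B = has_hole r h B A.
Proof.
move=> rsym; wlog suff H : A B / has_hole r h A B -> has_hole r h B A.
  by apply/idP/idP; apply: H.
case/existsP=> XY /and5P[XA YB hX hY nXY]; apply/existsP; exists (XY.2, XY.1).
by rewrite /is_hole /= YB XA hX hY no_edges_sym.
Qed.

(* The case [A = B] is not excluded: a cluster may be hole-free with itself. *)
Definition reduced (V : finType) (r : rel V) (h : nat) (P : {set {set V}}) :
    rel {set V} :=
  fun A B => [&& A \in P, B \in P & ~~ has_hole r h A B].

(** * Linking paths inside a component of the reduced graph *)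

Section Chaining.
Variables (V : finType) (r : rel V) (P : {set {set V}}) (h : nat).
Hypothesis trivP : trivIset P.
Local Notation e := (reduced r h P).

(** Greedy extension: hole-freeness leaves fewer than [h] vertices of [Z C] without a red neighbour
    among the at least [h] current ends, so at least [h] of the [2 * h] vertices of [Z C] are
    reached. The clusters in [cs] are distinct and hence disjoint, so no vertex repeats. *)
Lemma connecting_path (Z : {set V} -> {set V}) (cs : seq {set V})
    (A B A0 B0 : {set V}) :
  path e A (rcons cs B) -> uniq cs ->
  (forall C, C \in cs -> Z C \subset C /\ 2 * h <= #|Z C|) ->
  A0 \subset A -> h <= #|A0| -> B0 \subset B -> h <= #|B0| ->
  exists u zs v, [/\ u \in A0, v \in B0, path r u (rcons zs v) &
    [/\ uniq zs, size zs = size cs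
      & forall z, z \in zs -> exists2 C, C \in cs & z \in Z C]].
Proof.
elim: cs A A0 => [|C cs IH] A A0 /=.
  rewrite andbT => /and3P[_ _ nh] _ _ AA hA BB hB.
  have [u [v [uA vB ruv]]] := no_holeP nh AA BB hA hB.
  by exists u, [::], v; split=> //=; rewrite ruv.
case/andP=> /and3P[_ CP nh] pC /andP[Ccs ucs] HZ AA hA BB hB.
have [ZC hZC] := HZ C (mem_head _ _).
pose A1 := [set z in Z C | [exists u in A0, r u z]].
have hA1 : h <= #|A1|.
  rewrite leqNgt; apply/negP => ltA1.
  have hD : h <= #|Z C :\: A1|.
    have := cardsID A1 (Z C); have : #|Z C :&: A1| <= #|A1|.
      by apply: subset_leq_card; rewrite subsetIr.
    by move: hZC ltA1; clear; lia.
  have [u [z [uA]]] := no_holeP nh AA (subset_trans (subsetDl _ A1) ZC) hA hD.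
  rewrite !inE => /andP[+ zZ] ruz; rewrite zZ /= => /existsPn/(_ u).
  by rewrite uA ruz.
have [||z [zs [v [zA1 vB pzv [uzs szs HzsZ]]]]] := IH C A1 pC ucs _ _ hA1 BB hB.
- by move=> C' C'cs; apply: HZ; rewrite inE C'cs orbT.
- by apply: subset_trans ZC; apply/subsetP=> z; rewrite inE => /andP[].
move: zA1; rewrite inE => /andP[zZ /exists_inP[u uA ruz]].
exists u, (z :: zs), v; split=> //=; first by rewrite ruz.
split=> [||w].
- rewrite uzs andbT; apply/negP => /HzsZ[C' C'cs zC'].
  have [] := HZ C'; rewrite ?inE ?C'cs ?orbT // => ZC' _.
  have C'P : C' \in P.
    have /allP/(_ C') : all (mem P) cs.
      elim: (cs) (C) pC {CP} => //= D ds IHds C0 /andP[/and3P[_ DP _] /IHds ->].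
      by rewrite andbT.
    by apply.
  move: Ccs; rewrite (trivIset_eq trivP CP C'P (subsetP ZC z zZ)) ?C'cs //.
  exact: subsetP ZC' z zC'.
- by rewrite szs.
- rewrite inE => /orP[/eqP->|/HzsZ[C' C'cs wC']].
    by exists C => //; rewrite mem_head.
  by exists C' => //; rewrite inE C'cs orbT.
Qed.

Lemma reduced_connect_path (A B : {set V}) :
  connect e A B -> A != B ->
  exists cs, [/\ path e A (rcons cs B), uniq cs, {subset cs <= P}
               & size cs <= #|P|].
Proof.
case/connectP=> p pA ->; case/shortenP: pA => p' pA up _.
case/lastP: p' pA up => [|cs C]; first by rewrite /= eqxx.
rewrite last_rcons => pA /= /andP[_]; rewrite rcons_uniq => /andP[_ ucs] _.
have sP : {subset cs <= P}.
  elim: cs (A) pA {ucs} => //= D ds IH A' /andP[/and3P[_ DP _] /IH sub] E.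
  by rewrite inE => /orP[/eqP->|/sub].
exists cs; split=> //; rewrite -(card_uniqP ucs).
exact/subset_leq_card/subsetP.
Qed.

Variables (R Z : {set V} -> {set V}) (w : nat).
Hypothesis h0 : #|P| ^ 2 <= h.
Hypothesis ZP : forall C, C \in P -> Z C \subset C /\ 3 * h <= #|Z C|.

(** The window condition leaves, near any place of the path, enough vertices of the cluster [A] to
    enter or leave through a hole-free pair. *)
Definition threadable (A : {set V}) : Prop :=
  exists q, [/\ sorted r q, uniq q, {subset q <= R A}, w <= size q
    & forall s1 s2 s3, q = s1 ++ s2 ++ s3 -> size s2 = 2 * h ->
        h <= count (mem A) s2].

(** The paths of the clusters are linked one after another. A link cuts at most [2 * h] vertices off
    each of the two paths it joins and runs through the reservoirs [Z C], which the paths of the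
    clusters avoid. *)
Lemma chain_paths (D : seq {set V}) :
  4 * h <= w -> uniq D -> {subset D <= P} ->
  {in D &, forall A B, connect e A B} ->
  {in D &, forall A B, A != B -> [disjoint R A & R B]} ->
  {in D & P, forall A C, [disjoint R A & Z C]} ->
  {in D, forall A, threadable A} ->
  exists s, [/\ sorted r s, uniq s & size D * w <= size s + size D * (4 * h)].
Proof.
move=> hw uD DP conD disjR disjRZ thD.
have [->|D0] := eqVneq D [::]; first by exists [::].
(* The last [2 * h] vertices [s2] provide the exit into the next link; the last clause bounds how
   much of each reservoir the links have consumed. *)
suff H : forall (A : {set V}) (D' : seq {set V}),
    (exists D2, D = D2 ++ A :: D') -> exists s s1 s2,
    [/\ sorted r s, uniq s, size (A :: D') * w <= size s + size D' * (4 * h)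
      & [/\ s = s1 ++ s2, size s2 = 2 * h, h <= count (mem A) s2,
    forall x, x \in s -> (exists2 B, B \in A :: D' & x \in R B) \/
                         (exists2 C, C \in P & x \in Z C)
    & forall C, C \in P -> #|[set x in Z C | x \in s]| <= size D' * #|P|]].
  case: (D) D0 H => // A D' _ /(_ A D') [|s [_ [_ [ss us les _]]]].
    by exists [::].
  exists s; split=> //; apply: leq_trans les _.
  by rewrite leq_add2l leq_mul2r leqnSn orbT.
move=> A D'; elim: D' A => [|A D' IH] A' [D2 eqD].
  have A'D : A' \in D by rewrite eqD mem_cat mem_head orbT.
  have [q [sq uq qR wq chq]] := thD _ A'D.
  have hq := leq_trans hw wq.
  have sz : size (drop (size q - 2 * h) q) = 2 * h.
    by rewrite size_drop; move: hq; clear; lia.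
  exists q, (take (size q - 2 * h) q), (drop (size q - 2 * h) q); split=> //.
    by rewrite /= mul1n mul0n addn0.
  split=> //; first by rewrite cat_take_drop.
  - apply: (chq (take (size q - 2 * h) q) _ [::]) => //.
    by rewrite cats0 cat_take_drop.
  - by move=> x /qR xR; left; exists A'; rewrite ?mem_head.
  - move=> C CP; rewrite mul0n leqn0 cards_eq0; apply/eqP/setP => x.
    rewrite !inE; apply/negP=> /andP[xZ /qR xR].
    by have := disjRZ _ _ A'D CP => /pred0P/(_ x) /=; rewrite xR xZ.
have [|s [s1 [s2 [ss us les [es ss2 cs2 Hs HZ]]]]] := IH A.
  by exists (rcons D2 A'); rewrite cat_rcons.
have A'D : A' \in D by rewrite eqD mem_cat mem_head orbT.
have AD' : {subset A :: D' <= D}.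
  by move=> B BD; rewrite eqD mem_cat [B \in A' :: _]inE BD !orbT.
have nA' : A' \notin A :: D'.
  by move: uD; rewrite eqD cat_uniq cons_uniq => /and3P[_ _ /andP[]].
have neA : A != A' by move: nA'; rewrite inE negb_or eq_sym => /andP[].
have [q [sq uq qR wq chq]] := thD _ A'D.
have [cs [pcs ucs csP scs]] :=
  reduced_connect_path (conD A A' (AD' _ (mem_head _ _)) A'D) neA.
pose t1 := take (2 * h) q; pose t2 := drop (2 * h) q.
have eq_q : q = t1 ++ t2 by rewrite cat_take_drop.
have hq := leq_trans hw wq.
have st1 : size t1 = 2 * h by rewrite size_takel //; move: hq; clear; lia.
have ct1 : h <= count (mem A') t1 by apply: (chq [::] t1 t2).
have card_count (B : {set V}) (t : seq V) : uniq t ->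
    #|[set x in t | x \in B]| = count (mem B) t.
  move=> ut; rewrite -size_filter -(card_uniqP (filter_uniq _ ut)).
  by apply: eq_card => x; rewrite inE mem_filter andbC.
have us2 : uniq s2 by move: us; rewrite es cat_uniq => /and3P[].
have ut1 : uniq t1 by apply: take_uniq.
pose Z' C := Z C :\: [set x in s].
have [|||||u [zs [v [uA vB puv [uzs szs zsZ]]]]] :=
  @connecting_path Z' cs A A' [set x in s2 | x \in A]
    [set x in t1 | x \in A'] pcs ucs.
- move=> C /csP CP; have [ZC hZC] := ZP CP; split.
    by apply: subset_trans ZC; apply: subsetDl.
  have := cardsID [set x in s] (Z C); rewrite -/(Z' C).
  have -> : Z C :&: [set x in s] = [set x in Z C | x \in s].
    by apply/setP=> x; rewrite !inE.
  (* Each link uses at most [#|P|] vertices, so at most [#|P| ^ 2 <= h] vertices of the reservoir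
     are gone and [2 * h] of its [3 * h] remain. *)
  have := HZ C CP; have : size D' * #|P| <= h.
    apply: leq_trans h0; rewrite -mulnn leq_mul2r; apply/orP; right.
    have uD' : uniq D' by move: uD; rewrite eqD cat_uniq /= => /and5P[].
    rewrite -(card_uniqP uD'); apply/subset_leq_card/subsetP => B BD'.
    by apply/DP/AD'; rewrite inE BD' orbT.
  by move: hZC; clear; lia.
- by apply/subsetP=> x; rewrite inE => /andP[].
- by rewrite card_count.
- by apply/subsetP=> x; rewrite inE => /andP[].
- by rewrite card_count.
move: uA vB; rewrite !inE => /andP[us2' uA] /andP[vt1 vA'].
have [s21 [s22 es2]] : exists s21 s22, s2 = s21 ++ u :: s22.
  by case/splitPr: us2' => s21 s22; exists s21, s22.
have [t11 [t12 et1]] : exists t11 t12, t1 = t11 ++ v :: t12.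
  by case/splitPr: vt1 => t11 t12; exists t11, t12.
(* [sl] is the old path up to the exit [u], and [qr] is the new one from the entrance [v]. *)
pose sl := s1 ++ rcons s21 u; pose qr := v :: t12 ++ t2.
have esl : s = sl ++ s22 by rewrite es es2 /sl -cat_rcons !catA.
have eqr : q = t11 ++ qr by rewrite eq_q et1 -catA.
have sz_sl : size s <= size sl + 2 * h.
  rewrite esl size_cat leq_add2l -ss2 es2 size_cat /= ltnW //.
  by rewrite addnS ltnS leq_addl.
have sz_qr : size q <= size qr + 2 * h.
  rewrite eqr size_cat addnC leq_add2l -st1 et1 size_cat /=.
  by rewrite leq_addr.
have sls x : x \in sl -> x \in s by move=> xs; rewrite esl mem_cat xs.
have qrq x : x \in qr -> x \in q by move=> xq; rewrite eqr mem_cat xq orbT.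
have zsZ2 z : z \in zs ->
    exists C, [/\ C \in cs, C \in P, z \in Z C & z \notin s].
  case/zsZ=> C Ccs; rewrite !inE => /andP[zs' zZ].
  by exists C; split=> //; apply: csP.
exists (sl ++ zs ++ qr), (sl ++ zs ++ take (size qr - 2 * h) qr),
  (drop (size qr - 2 * h) qr).
have hqr : 2 * h <= size qr by move: sz_qr hq; clear; lia.
have [x0 [sl' [exl lu]]] : exists x0 sl', sl = x0 :: sl' /\ last x0 sl' = u.
  case: {-2}sl (erefl sl) => [|x sl'] exl.
    by move/(congr1 size): exl; rewrite size_cat size_rcons addnS.
  exists x, sl'; split=> //; have := congr1 (last x) exl.
  by rewrite /sl last_cat last_rcons.
have [q2 eqv] : exists q2, qr = v :: q2 by eexists.
clearbody sl qr.
split.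
- have : sorted r sl by move: ss; rewrite esl => /cat_sorted2[].
  have : sorted r qr by move: sq; rewrite eqr => /cat_sorted2[].
  rewrite exl eqv /= -cat_rcons !cat_path lu last_rcons puv => -> ->.
  by [].
- rewrite !cat_uniq uzs.
  have -> : uniq sl by move: us; rewrite esl cat_uniq => /and3P[].
  have -> : uniq qr by move: uq; rewrite eqr cat_uniq => /and3P[].
  rewrite andbT /=; apply/andP; split.
    rewrite has_cat negb_or; apply/andP; split.
      apply/hasPn => z /zsZ2[C [_ _ _]]; apply: contra; exact: sls.
    apply/hasPn => x /qrq/qR xR; apply/negP => /sls/Hs[[B BD xB]|[C CP xZ]].
      have neB : A' != B by apply: contraNneq nA' => ->.
      have /pred0P/(_ x) /= := disjR _ _ A'D (AD' _ BD) neB.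
      by rewrite xR xB.
    by have := disjRZ _ _ A'D CP => /pred0P/(_ x) /=; rewrite xR xZ.
  apply/hasPn => x /qrq/qR xR; apply/negP => /zsZ2[C [_ CP xZ _]].
  by have := disjRZ _ _ A'D CP => /pred0P/(_ x) /=; rewrite xR xZ.
- rewrite !size_cat; move: les wq sz_sl sz_qr => /=; clear.
  by move: (size D') => d; lia.
split.
- by rewrite -!catA cat_take_drop.
- by rewrite size_drop; move: hqr; clear; lia.
- apply: (chq (t11 ++ take (size qr - 2 * h) qr) _ [::]).
    by rewrite cats0 -catA cat_take_drop.
  by rewrite size_drop; move: hqr; clear; lia.
- move=> x; rewrite !mem_cat.
  case/or3P=> [/sls/Hs[[B BD xB]|]|/zsZ2[C [_ CP xZ _]]|/qrq/qR xR].
  + by left; exists B => //; rewrite inE BD orbT.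
  + by right.
  + by right; exists C.
  + by left; exists A' => //; rewrite mem_head.
- move=> C CP; have := HZ C CP.
  have : #|[set x in Z C | x \in sl ++ zs ++ qr]| <=
      #|[set x in Z C | x \in s]| + size zs.
    apply: leq_trans (_ : #|[set x in Z C | x \in s] :|: [set x in zs]| <= _).
      apply: subset_leq_card; apply/subsetP=> x; rewrite !inE !mem_cat.
      case/andP=> xZ /or3P[/sls xs|->|/qrq/qR xR].
      + by rewrite xZ xs.
      + by rewrite orbT.
      + by have := disjRZ _ _ A'D CP => /pred0P/(_ x) /=; rewrite xR xZ.
    apply: leq_trans (leq_card_setU _ _) _.
    by rewrite leq_add2l cardsE card_size.
  move=> ub1 ub2; rewrite szs in ub1; rewrite mulSn (leq_trans ub1) // addnC.
  exact: leq_add scs ub2.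
Qed.
End Chaining.

(** * Hall's theorem with deficiency, and long paths from matchings *)

Definition nbrs (T U : finType) (e : T -> U -> bool) (I : {set T}) : {set U} :=
  [set y | [exists x in I, e x y]].

Lemma nbrsP (T U : finType) (e : T -> U -> bool) (I : {set T}) y :
  reflect (exists2 x, x \in I & e x y) (y \in nbrs e I).
Proof. by rewrite inE; apply: exists_inP. Qed.

(** Induction on [#|C|]: if a nonempty proper subset [I] is tight, match [I] first and the rest
    outside its neighbourhood; otherwise any edge from [x0] to [y0] can be fixed, since every
    nonempty proper subset has a neighbour to spare and can do without [y0]. The point [u0] provides
    values when [C] is empty. *)
Lemma hall (T U : finType) (u0 : U) (e : T -> U -> bool) (C : {set T}) :
  (forall I : {set T}, I \subset C -> #|I| <= #|nbrs e I|) ->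
  exists2 phi : T -> U, {in C &, injective phi} & {in C, forall x, e x (phi x)}.
Proof.
have [m] := ubnP #|C|; elim: m e C => // m IH e C /ltnSE leC HC.
have [->|/set0Pn[x0 x0C]] := eqVneq C set0.
  by exists (fun=> u0) => x; rewrite ?inE.
have [/existsP[I /and3P[I0 IC cI]]|tight] := boolP
  [exists I : {set T}, [&& I != set0, I \proper C & #|nbrs e I| <= #|I|]].
  have IsC := proper_sub IC.
  have [|J JI|phi1 inj1 e1] := IH e I.
  - exact: leq_trans (proper_card IC) leC.
  - exact/HC/(subset_trans JI).
  pose e' x y := e x y && (y \notin nbrs e I).
  have [|J|phi2 inj2 e2] := IH e' (C :\: I).
  - have := cardsID I C; rewrite (setIidPr IsC); move: leC I0.
    by rewrite -card_gt0; clear; lia.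
  - rewrite subsetD => /andP[JC dJI].
    have := HC (I :|: J); rewrite subUset IsC JC => /(_ isT).
    rewrite cardsU setIC (disjoint_setI0 dJI) cards0 subn0.
    have sub : nbrs e (I :|: J) \subset nbrs e I :|: nbrs e' J.
      apply/subsetP=> y /nbrsP[x]; rewrite in_setU => xIJ exy.
      rewrite in_setU; case: (boolP (y \in nbrs e I)) => //= yI.
      apply/nbrsP; exists x; last by rewrite /e' exy.
      case/orP: xIJ => // xI; case/negP: yI; apply/nbrsP; by exists x.
    have := leq_trans (subset_leq_card sub) (leq_card_setU _ _).
    by move: cI; clear; lia.
  have phiN x : x \in I -> phi1 x \in nbrs e I.
    by move=> xI; apply/nbrsP; exists x => //; apply: e1.
  have phiN2 x : x \in C -> x \notin I -> phi2 x \notin nbrs e I.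
    by move=> xC xI; have /andP[] : e' x (phi2 x) by apply: e2; rewrite inE xI.
  exists (fun x => if x \in I then phi1 x else phi2 x) => [z w zC wC|z zC].
    case: ifPn => zI; case: ifPn => wI.
    - exact: inj1.
    - by move=> E; case/negP: (phiN2 w wC wI); rewrite -E phiN.
    - by move=> E; case/negP: (phiN2 z zC zI); rewrite E phiN.
    - by apply: inj2; rewrite inE ?zI ?wI.
  case: ifPn => zI; first exact: e1.
  by have /andP[] : e' z (phi2 z) by apply: e2; rewrite inE zI.
have x0x0 : [set x0] \subset C by rewrite sub1set.
have /card_gt0P[y0 /nbrsP[x]] : 0 < #|nbrs e [set x0]|.
  by apply: leq_trans (HC _ x0x0); rewrite cards1.
rewrite inE => /eqP-> ey0.
pose e' x y := e x y && (y != y0).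
have [|J|phi injphi ephi] := IH e' (C :\ x0).
- by have := cardsD1 x0 C; rewrite x0C; move: leC; clear; lia.
- rewrite subsetD1 => /andP[JC x0J].
  have -> : nbrs e' J = nbrs e J :\ y0.
    apply/setP=> y; rewrite !inE; apply/exists_inP/andP.
      by case=> z zJ /andP[ezy ->]; split=> //; apply/exists_inP; exists z.
    by case=> yy0 /exists_inP[z zJ ezy]; exists z; rewrite // /e' ezy.
  have [->|J0] := eqVneq J set0; first by rewrite cards0.
  have JpC : J \proper C.
    by rewrite properEneq JC andbT; apply: contraNneq x0J => ->.
  move: tight => /existsPn/(_ J); rewrite J0 JpC /= -ltnNge.
  by have := cardsD1 y0 (nbrs e J); case: (y0 \in _); clear; lia.
exists (fun x => if x == x0 then y0 else phi x) => [z w zC wC|z zC].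
  case: (eqVneq z x0) => [->|zx0]; case: (eqVneq w x0) => [->|wx0] //.
  - have /andP[_ /eqP nw] : e' w (phi w) by apply: ephi; rewrite !inE wx0.
    by move=> E; case: nw.
  - have /andP[_ /eqP nz] : e' z (phi z) by apply: ephi; rewrite !inE zx0.
    by [].
  - by apply: injphi; rewrite !inE ?zx0 ?wx0.
case: (eqVneq z x0) => [->//|zx0].
by have /andP[] : e' z (phi z) by apply: ephi; rewrite !inE zx0.
Qed.

Lemma hall_deficiency (T U : finType) (u0 : U) (e : T -> U -> bool)
    (C : {set T}) (d : nat) :
  (forall I : {set T}, I \subset C -> #|I| <= #|nbrs e I| + d) ->
  exists (D : {set T}) (phi : T -> U), [/\ D \subset C, #|C| <= #|D| + d,
    {in D &, injective phi} & {in D, forall x, e x (phi x)}].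
Proof.
move=> HC.
(* The [d] elements of ['I_d] are additional neighbours of every vertex. *)
pose e' (x : T) (y : U + 'I_d) := if y is inl y' then e x y' else true.
have [I IC|psi injpsi epsi] := @hall T (U + 'I_d)%type (inl u0) e' C.
  have [->|/set0Pn[x0 x0I]] := eqVneq I set0; first by rewrite cards0.
  apply: leq_trans (HC I IC) _.
  have -> : nbrs e' I = [set inl y | y in nbrs e I] :|: [set inr y | y in 'I_d].
    apply/setP=> -[y|y]; rewrite in_setU.
    - rewrite [X in _ || X](_ : _ = false) ?orbF; last by apply/imsetP => -[].
      rewrite mem_imset; last by move=> ? ? [].
      by apply/nbrsP/nbrsP=> -[x xI exy]; exists x.
    - rewrite [X in _ || X](_ : _ = true) ?orbT; last by apply: imset_f.
      by apply/nbrsP; exists x0.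
  rewrite cardsU !card_imset; try by move=> ? ? [].
  rewrite card_ord.
  have -> : #|[set inl y | y in nbrs e I] :&: [set inr y | y in 'I_d]| = 0.
    apply/eqP; rewrite cards_eq0; apply/eqP/setP => z; rewrite !inE.
    by apply/negP => /andP[/imsetP[? _ ->] /imsetP[]].
  by rewrite subn0.
pose D := [set x in C | if psi x is inl _ then true else false].
exists D, (fun x => if psi x is inl y then y else u0).
have DC : D \subset C by apply/subsetP=> x; rewrite inE => /andP[].
split=> //.
- rewrite -(cardsID D C) (setIidPr DC) leq_add2l -[d]card_ord.
  rewrite -(card_in_imset (f := psi)); last first.
    by move=> x y /setDP[xC _] /setDP[yC _]; apply: injpsi.
  rewrite -(card_imset (mem 'I_d) (f := @inr U 'I_d)); last by move=> ? ? [].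
  apply/subset_leq_card/subsetP => z /imsetP[x]; rewrite !inE => /andP[+ xC] ->.
  by rewrite xC /=; case: (psi x) => // i _; apply: imset_f.
- move=> x y; rewrite !inE => /andP[xC +] /andP[yC +].
  case Ex: (psi x) => [a|] //; case Ey: (psi y) => [b|] // _ _ eab.
  by apply: injpsi; rewrite ?Ex ?Ey ?eab.
- move=> x; rewrite inE => /andP[xC]; have := epsi x xC.
  by rewrite /e'; case: (psi x).
Qed.

Lemma split_set (V : finType) (A : {set V}) (a b : nat) : 2 * a + b <= #|A| ->
  exists XYZ : {set V} * {set V} * {set V}, let: (X, Y, Z) := XYZ in
    [/\ [/\ X \subset A, Y \subset A & Z \subset A],
        [/\ [disjoint X & Y], [disjoint X & Z] & [disjoint Y & Z]]
      & [/\ #|X| = a, #|Y| = a & b <= #|Z|]].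
Proof.
move=> leA; have aA : a <= #|A| by move: leA; clear; lia.
have [X XA cX] := subset_of_card aA.
have cAX : #|A :\: X| = #|A| - a by rewrite cardsD (setIidPr XA) cX.
have aAX : a <= #|A :\: X| by rewrite cAX; move: leA; clear; lia.
have [Y YAX cY] := subset_of_card aAX.
have [YA dYX] : Y \subset A /\ [disjoint Y & X] by apply/andP; rewrite -subsetD.
exists (X, Y, (A :\: X) :\: Y); split; split=> //.
- by apply: subset_trans (subsetDl _ _) (subsetDl _ _).
- by rewrite disjoint_sym.
- rewrite disjoint_sym; apply: disjointWl (subsetDl _ _) _.
  by rewrite disjoints_subset setDE subsetIr.
- by rewrite disjoint_sym disjoints_subset setDE subsetIr.
- by rewrite cardsD (setIidPr YAX) cAX cY; move: leA; clear; lia.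
Qed.

Lemma has_holeS (V : finType) (r : rel V) (h : nat) (A B X Y : {set V}) :
  X \subset A -> Y \subset B -> has_hole r h X Y -> has_hole r h A B.
Proof.
move=> XA YB /existsP[[X' Y'] /and5P[/= XX YY hX hY nXY]].
apply/existsP; exists (X', Y').
by rewrite /is_hole /= hX hY nXY (subset_trans XX) // (subset_trans YY).
Qed.

(** The injection [phi] acts as a fractional matching: a cluster may occur once as [A] and once as
    [phi A], so it is split into halves [X] and [Y] for these two roles and a reservoir [Z] for the
    links. Per pair, at most [4 * h] vertices are lost to reservoir and rounding, [4 * h] inside the
    pair and [4 * h] in linking. *)
Lemma matched_path (V : finType) (r : rel V) (P : {set {set V}}) (l h : nat)
    (D : {set {set V}}) (phi : {set V} -> {set V}) :
  symmetric r -> trivIset P -> (forall A, A \in P -> #|A| = l) ->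
  #|P| ^ 2 <= h -> 0 < h -> 12 * h <= l -> D \subset P ->
  {in D &, forall A B, connect (reduced r h P) A B} ->
  {in D &, injective phi} ->
  {in D, forall A, reduced r h P A (phi A)} ->
  exists s, [/\ sorted r s, uniq s & #|D| * l <= size s + #|D| * (12 * h)].
Proof.
move=> rsym tP cP hP h0 hl /subsetP DP conD injphi ephi.
pose a := (l - 3 * h)./2.
have la : l <= 2 * a + 3 * h + 1 by rewrite /a; move: hl; clear; lia.
have al : 2 * a + 3 * h <= l by rewrite /a; move: hl; clear; lia.
have : forall A : {set V}, exists XYZ : {set V} * {set V} * {set V}, A \in P ->
   let: (X, Y, Z) := XYZ in
    [/\ [/\ X \subset A, Y \subset A & Z \subset A],
        [/\ [disjoint X & Y], [disjoint X & Z] & [disjoint Y & Z]]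
      & [/\ #|X| = a, #|Y| = a & 3 * h <= #|Z|]].
  move=> A; have [AP|_] := boolP (A \in P); last by exists (set0, set0, set0).
  by have [|XYZ HXYZ] := @split_set V A a (3 * h); [rewrite cP | exists XYZ].
case/fin_all_exists => F HF.
pose X A := (F A).1.1; pose Y A := (F A).1.2; pose Z A := (F A).2.
have {}HF A : A \in P -> [/\ [/\ X A \subset A, Y A \subset A & Z A \subset A],
        [/\ [disjoint X A & Y A], [disjoint X A & Z A] & [disjoint Y A & Z A]]
      & [/\ #|X A| = a, #|Y A| = a & 3 * h <= #|Z A|]].
  by move/HF; rewrite /X /Y /Z; case: (F A) => -[].
clearbody X Y Z.
have disjP (A B A' B' : {set V}) : A \in P -> B \in P -> A != B ->
    A' \subset A -> B' \subset B -> [disjoint A' & B'].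
  move=> AP BP neAB AA BB; apply: disjointWl AA (disjointWr BB _).
  by move/trivIsetP: tP => /(_ A B AP BP neAB).
have phiP A : A \in D -> phi A \in P by case/ephi/and3P.
have disjXY A B : A \in P -> B \in P -> [disjoint X A & Y B].
  move=> AP BP; have [[XA _ _] [dXY _ _] _] := HF _ AP.
  have [[_ YB _] _ _] := HF _ BP.
  by have [<-//|neAB] := eqVneq A B; apply: disjP neAB XA YB.
pose R A := X A :|: Y (phi A).
have disjU (A B C : {set V}) : [disjoint A & C] -> [disjoint B & C] ->
    [disjoint A :|: B & C].
  by rewrite !disjoints_subset subUset => -> ->.
have [|||||||s [ss us les]] := @chain_paths V r P h tP R Z (l - 8 * h)
  hP _ (enum D) _ (enum_uniq _).
- by move=> A AP; have [[_ _ ZA] _ [_ _ cZ]] := HF _ AP.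
- by move: hl; clear; lia.
- by move=> A; rewrite mem_enum => /DP.
- by move=> A B; rewrite !mem_enum; apply: conD.
- move=> A B; rewrite !mem_enum => AD BD neAB.
  have [AP BP pAP pBP] := And4 (DP _ AD) (DP _ BD) (phiP _ AD) (phiP _ BD).
  have neph : phi A != phi B by apply: contraNneq neAB => /injphi->.
  have [[XA _ _] _ _] := HF _ AP; have [[XB _ _] _ _] := HF _ BP.
  have [[_ YA _] _ _] := HF _ pAP; have [[_ YB _] _ _] := HF _ pBP.
  apply: (disjU); rewrite disjoint_sym; apply: (disjU).
  + by rewrite disjoint_sym; apply: disjP neAB XA XB.
  + by rewrite disjoint_sym disjXY.
  + exact: disjXY.
  + by rewrite disjoint_sym; apply: disjP neph YA YB.
- move=> A C; rewrite mem_enum => AD CP.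
  have [[XA _ _] [_ dXZ _] _] := HF _ (DP _ AD).
  have [[_ YA _] [_ _ dYZ] _] := HF _ (phiP _ AD).
  have [[_ _ ZC] _ _] := HF _ CP.
  apply: disjU.
    by have [<-//|neAC] := eqVneq A C; apply: disjP (DP _ AD) CP neAC XA ZC.
  have [<-//|neAC] := eqVneq (phi A) C.
  exact: disjP (phiP _ AD) CP neAC YA ZC.
- move=> A; rewrite mem_enum => AD.
  have [[XA _ _] _ [cX _ _]] := HF _ (DP _ AD).
  have [[_ YA _] _ [_ cY _]] := HF _ (phiP _ AD).
  have [|||q [sq uq qR leq]] :=
    @alternating_path V r (X A) (Y (phi A)) h rsym h0.
  + exact: disjXY (DP _ AD) (phiP _ AD).
  + by rewrite cX cY.
  + have /and3P[_ _] := ephi _ AD; apply: contra.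
    exact: has_holeS.
  exists q; split=> //.
  + by apply: sub_sorted sq => u v /andP[].
  + by move: leq; rewrite cX; move: la h0; clear; lia.
  + move=> s1 s2 s3 eq_q ss2.
    have : sorted (fun u v => (u \notin X A) != (v \notin X A)) s2.
      have : sorted (fun u v => r u v && ((u \in X A) != (v \in X A))) s2.
        by move: sq; rewrite eq_q => /cat_sorted2[_ /cat_sorted2[]].
      apply: sub_sorted => u v /andP[_].
      by case: (u \in _) (v \in _) => -[].
    move/alternating_count; rewrite ss2.
    have := count_predC (mem (X A)) s2; rewrite ss2.
    have -> : count (predC (mem (X A))) s2 = count (fun u => u \notin X A) s2.
      by [].
    have : count (mem (X A)) s2 <= count (mem A) s2.
      by apply: sub_count => x; apply: (subsetP XA).
    by move: (count _ s2) (count _ s2) (count _ s2); clear; lia.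
exists s; split=> //; move: les; rewrite -cardE mulnBr.
have : #|D| * (8 * h) <= #|D| * l.
  by rewrite leq_mul2l; apply/orP; right; move: hl; clear; lia.
have -> : #|D| * (12 * h) = #|D| * (8 * h) + #|D| * (4 * h).
  by rewrite -mulnDr -mulnDl.
by move: (#|D| * l) (#|D| * (8 * h)) (#|D| * (4 * h)); clear; lia.
Qed.

(** * The block structure *)

Lemma arith_deficiency (c j s js jd sd ni m : nat) :
  s + (c - m) < j -> m <= c -> j <= c -> js + jd = j -> js + sd = s ->
  ni <= sd -> c - jd + ni < m.
Proof. lia. Qed.

(** A matching of [m] clusters would give too long a path, so Hall's condition with deficiency fails
    for some [J]. Removing from [J] its neighbourhood [S] makes it independent and does not decrease
    its excess over its neighbourhood. *)
Lemma connected_cover (V : finType) (r : rel V) (P C : {set {set V}})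
    (l h n : nat) :
  symmetric r -> trivIset P -> (forall A, A \in P -> #|A| = l) ->
  #|P| ^ 2 <= h -> 0 < h -> 12 * h < l -> C \subset P ->
  {in C &, forall A B, connect (reduced r h P) A B} ->
  (forall s, sorted r s -> uniq s -> size s < n) ->
  exists I : {set {set V}},
    [/\ I \subset C, {in I &, forall A B, ~~ reduced r h P A B},
        I = set0 \/ n <= #|C| * (l - 12 * h)
      & (#|C| - #|I| + #|nbrs (reduced r h P) I|) * (l - 12 * h) <= n].
Proof.
move=> rsym tP cP hP h0 hl CP conC short; set e := reduced r h P.
have esym : symmetric e.
  by move=> A B; rewrite /e /reduced has_hole_sym // andbCA.
have y0 : 0 < l - 12 * h by rewrite subn_gt0.
have [leC|ltC] := leqP (#|C| * (l - 12 * h)) n.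
  exists set0; split.
  - exact: sub0set.
  - by move=> A B; rewrite inE.
  - by left.
  - rewrite cards0 subn0 (_ : nbrs e set0 = set0) ?cards0 ?addn0 //.
    by apply/setP=> B; rewrite in_set0; apply/nbrsP => -[A]; rewrite inE.
(* The least number of clusters whose shares of [l - 12 * h] vertices exceed [n] together. *)
pose m := (n %/ (l - 12 * h)).+1.
have mC : m <= #|C| by rewrite /m ltn_divLR // .
have [/forallP HC|/forallPn[J]] := boolP [forall J : {set {set V}},
    (J \subset C) ==> (#|J| <= #|nbrs e J| + (#|C| - m))].
  have [|D [phi [DC cD injphi ephi]]] :=
    @hall_deficiency _ _ set0 e C (#|C| - m).
    by move=> J JC; apply: (implyP (HC J)).
  have [||s [ss us les]] := @matched_path V r P l h D phi rsym tP cP hP h0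
    (ltnW hl) _ _ injphi ephi.
  - exact: subset_trans CP.
  - by move=> A B /(subsetP DC) AinC /(subsetP DC); apply: conC.
  have := short s ss us; rewrite ltnNge => /negP[].
  have : m * (l - 12 * h) <= #|D| * (l - 12 * h).
    rewrite leq_mul2r; apply/orP; right.
    by rewrite -(leq_add2r (#|C| - m)) subnKC.
  move=> leD; apply: leq_trans (ltnW (ltn_ceil n y0)) (leq_trans leD _).
  by rewrite mulnBr leq_subLR addnC.
rewrite negb_imply -ltnNge => /andP[JC ltJ].
set S := nbrs e J in ltJ; exists (J :\: S).
have NI : nbrs e (J :\: S) \subset S :\: J.
  apply/subsetP=> B /nbrsP[A]; rewrite inE => /andP[AS AJ] eAB.
  rewrite inE; apply/andP; split; last by apply/nbrsP; exists A.
  by apply: contra AS => BJ; apply/nbrsP; exists B; rewrite // esym.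
split.
- exact: subset_trans (subsetDl _ _) JC.
- move=> A B AI BI; apply: contraL BI => eAB.
  have : B \in nbrs e (J :\: S) by apply/nbrsP; exists A.
  by move/(subsetP NI); rewrite !inE => /andP[/negPf->]; rewrite andbF.
- by right; apply: ltnW.
- rewrite -leq_divRL // -ltnS -/m.
  have cS := cardsID J S; rewrite setIC in cS.
  exact: arith_deficiency ltJ mC (subset_leq_card JC) (cardsID S J) cS
    (subset_leq_card NI).
Qed.

(** If the cap [a] binds, the value is [a + l * i], while the component has at most [n' + l * i]
    vertices. If it does not, only the [l * s] vertices of the neighbourhood are lost; [i + s <= c]
    bounds them by [n' / 2 <= n' - a], and a component with at least [n] vertices keeps
    [n - n' / 2 >= b] of them. *)
Lemma arith_component (l y c i s n n' a b : nat) :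
  i + s <= c -> i = 0 /\ s = 0 \/ n <= c * y -> y <= l ->
  (c - i + s) * l <= n' -> 2 * a <= n' -> b <= a -> 2 * b + n' <= 2 * n ->
  let v := minn (l * (c - i - s)) a + l * i in
  l * c <= v \/ b <= v /\ l * c + a <= v + n'.
Proof.
move=> isc cases yl lex an ba bn.
have {cases} : l * i = 0 /\ l * s = 0 \/ n <= l * c.
  case: cases => [[-> ->]|nc]; first by left; rewrite !muln0.
  by right; apply: leq_trans nc _; rewrite mulnC leq_mul2r yl orbT.
have : l * i + l * s <= l * c by rewrite -mulnDr leq_mul2l isc orbT.
rewrite !mulnBr; move: lex; rewrite mulnDl mulnBl.
rewrite ![_ * l]mulnC; move: (l * c) (l * i) (l * s) => tc ti ts /=.
by move: an ba bn; clear; lia.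
Qed.

(* [t C] is the number of vertices of the component [C] and [val C] the part of
   it that packing can use; a loss of [n' - a], about [n / 2], is affordable [k]
   times, while [k + 1] components of value [b], about [n / 2], suffice. *)
Lemma sum_component_values (T : finType) (Q : {set T}) (t val : T -> nat)
    (k b n' a a0 : nat) :
  a <= n' -> k * a + a0 <= k.+1 * b ->
  {in Q, forall C, t C <= val C \/ (b <= val C /\ t C + a <= val C + n')} ->
  k * n' + a0 <= \sum_(C in Q) t C ->
  k * a + a0 <= \sum_(C in Q) val C.
Proof.
move=> an hk HQ ht; pose F := [set C in Q | val C < t C].
have FQ : F \subset Q by apply/subsetP=> C; rewrite inE => /andP[].
have HF C : C \in F -> b <= val C.
  by rewrite inE => /andP[/HQ[|[//]]]; rewrite leqNgt => /negPf->.
have [kF|Fk] := ltnP k #|F|.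
  have : \sum_(C in F) val C <= \sum_(C in Q) val C.
    rewrite [leqRHS](big_setID F) (setIidPr FQ); exact: leq_addr.
  apply: leq_trans; apply: leq_trans (_ : \sum_(C in F) b <= _).
    by rewrite sum_nat_const (leq_trans hk) // leq_mul2r kF orbT.
  exact: leq_sum.
have : \sum_(C in Q) t C <= \sum_(C in Q) (val C + (C \in F) * (n' - a)).
  apply: leq_sum => C CQ; rewrite inE CQ /=.
  case: (ltnP (val C) (t C)) => [lt|]; last by rewrite addn0.
  case: (HQ C CQ) => [|[_]]; first by rewrite leqNgt lt.
  by move: an; clear; lia.
rewrite big_split -big_distrl /=.
have -> : \sum_(C in Q) (C \in F) = #|F|.
  rewrite -sum1_card [RHS]big_mkcond [LHS]big_mkcond; apply: eq_bigr => C _.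
  by case: (boolP (C \in F)) => [/(subsetP FQ)->|_] //; rewrite if_same.
have := leq_mul Fk (leqnn (n' - a)).
rewrite [k * (n' - a)]mulnBr; have := leq_mul (leqnn k) an.
by move: ht; move: (k * n') (k * a) (#|F| * _); clear; lia.
Qed.

(* The blocks are the sets [W] of the components, indexed by [inl], and the
   singletons of the vertices in the independent sets [I], indexed by [inr];
   all other indices carry the empty block. *)
Lemma blocks_of_components (V : finType) (r : rel V) (P : {set {set V}})
    (l h n n' a a0 b k eps : nat) :
  symmetric r -> trivIset P -> (forall A, A \in P -> #|A| = l) ->
  #|P| ^ 2 <= h -> 0 < h -> 12 * h < l ->
  (forall s, sorted r s -> uniq s -> size s < n) ->
  (forall A, A \in P -> #|[set B in P | bad_pair r h A B]| * l <= eps) ->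
  (forall x, x * (l - 12 * h) <= n -> x * l <= n') ->
  0 < a -> 2 * a <= n' -> b <= a -> 2 * b + n' <= 2 * n ->
  k * a + a0 <= k.+1 * b ->
  k * n' + a0 <= l * #|P| ->
  exists (K : finType) (B : K -> {set V}),
    [/\ forall i j, i != j -> [disjoint B i & B j],
        forall i v, v \in B i ->
          #|[set u in \bigcup_(j | j != i) B j | r v u]| <= eps
      & k * a + a0 <= \sum_i minn #|B i| a].
Proof.
move=> rsym tP cP hP h0 hl short badP hn' a1 an' ba bn hk hm.
set e := reduced r h P.
have esym : symmetric e.
  by move=> A B; rewrite /e /reduced has_hole_sym // andbCA.
have csym : connect_sym e by apply: sym_connect_sym.
pose cls A := [set B in P | connect e A B].
have compP A B : A \in P -> B \in P -> connect e A B -> cls A = cls B.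
  move=> AP BP cAB; apply/setP => D; rewrite !inE; case: (D \in P) => //=.
  by rewrite (same_connect csym cAB).
pose Q := cls @: P.
have QP C : C \in Q -> C \subset P.
  by case/imsetP=> A _ ->; apply/subsetP=> B; rewrite inE => /andP[].
have conQ C : C \in Q -> {in C &, forall A B, connect e A B}.
  case/imsetP=> D _ -> A B; rewrite !inE => /andP[_ cDA] /andP[_ cDB].
  by apply: connect_trans cDB; rewrite csym.
have clsQ C A : C \in Q -> A \in C -> C = cls A.
  move=> /imsetP[D DP ->]; rewrite inE => /andP[AP cDA].
  exact: compP.
have : forall C, exists I : {set {set V}}, C \in Q -> 
    [/\ I \subset C, {in I &, forall A B, ~~ e A B},
        I = set0 \/ n <= #|C| * (l - 12 * h)
      & (#|C| - #|I| + #|nbrs e I|) * (l - 12 * h) <= n].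
  move=> C; have [CQ|_] := boolP (C \in Q); last by exists set0.
  have [I HI] :=
    connected_cover rsym tP cP hP h0 hl (QP _ CQ) (conQ _ CQ) short.
  by exists I.
case/fin_all_exists => I HI.
pose W C := cover (C :\: I C :\: nbrs e (I C)).
pose J := \bigcup_(C in Q) I C.
have JP A : A \in J -> [/\ A \in P, cls A \in Q & A \in I (cls A)].
  case/bigcupP=> C CQ AI; have [IC _ _ _] := HI C CQ.
  have AinC := subsetP IC _ AI; rewrite -(clsQ _ _ CQ AinC).
  by split=> //; apply: subsetP (QP _ CQ) _ AinC.
pose B (i : {set {set V}} + V) : {set V} := match i with
  | inl C => if C \in Q then W C else set0
  | inr v => if v \in cover J then [set v] else set0 end.
have inBl C v : v \in B (inl C) ->
   exists A : {set V}, [/\ C \in Q, v \in A, A \in C,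
     A \notin I C & A \notin nbrs e (I C)].
  rewrite /=; case: ifP => [CQ|_]; last by rewrite inE.
  case/bigcupP=> A; rewrite in_setD in_setD => /and3P[nA IA AinC] vA.
  by exists A; split.
have inBr x v : v \in B (inr x) ->
   v = x /\ exists A : {set V}, A \in J /\ v \in A.
  rewrite /=; case: ifP => [|_]; last by rewrite inE.
  case/bigcupP=> A AJ xA; rewrite inE => /eqP->; split=> //; by exists A.
(* The cluster of a vertex decides which block contains it: the [W] of its component, or the vertex
   alone if the cluster lies in [I]. *)
have info i A u : u \in B i -> A \in P -> u \in A -> match i with
    | inl C => [/\ C = cls A, A \notin I C & A \notin nbrs e (I C)]
    | inr x => x = u /\ A \in I (cls A) end.
  case: i => [C|x] uB AP uA.
    have [A' [CQ uA' A'C nI nN]] := inBl C u uB.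
    have AA' := trivIset_eq tP AP (subsetP (QP _ CQ) _ A'C) uA uA'.
    by rewrite AA' -(clsQ _ _ CQ A'C).
  have [ux [A' [A'J uA']]] := inBr x u uB; have [A'P _ A'I] := JP _ A'J.
  by rewrite (trivIset_eq tP AP A'P uA uA') ux.
have coveredP i u : u \in B i -> exists2 A, A \in P & u \in A.
  case: i => [C|x] uB.
    have [A [CQ uA AinC _ _]] := inBl C u uB; exists A => //.
    exact: subsetP (QP _ CQ) _ AinC.
  have [_ [A [AJ uA]]] := inBr x u uB; have [AP _ _] := JP _ AJ; by exists A.
exists ({set {set V}} + V)%type, B; split.
- move=> i j neij; apply/pred0P => u; apply/negP => /andP[/= ui uj].
  have [A AP uA] := coveredP _ _ ui.
  have := info _ _ _ ui AP uA; have := info _ _ _ uj AP uA.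
  case: i j neij {ui uj} => [C|x] [D|y] neij.
  + by move=> [CA _ _] [DA _ _]; rewrite CA DA eqxx in neij.
  + by move=> [_ AI] [-> /negP].
  + by move=> [-> /negP nAI _] [_ /nAI].
  + by move=> [xu _] [yu _]; rewrite xu yu eqxx in neij.
- move=> i v vi; have [A AP vA] := coveredP _ _ vi.
  set bad := [set D in P | bad_pair r h A D].
  have badS : bad \subset P by apply/subsetP=> D; rewrite inE => /andP[].
  have cbad : #|cover bad| <= eps.
    have -> : #|cover bad| = l * #|bad|.
      apply: card_cover_eq; first exact: trivIsetS badS tP.
      by move=> D /(subsetP badS); apply: cP.
    by rewrite mulnC; apply: badP.
  (* A red edge to another block joins a bad pair of clusters: the pair is not free of red edges,
     and if it were hole-free, its clusters would be adjacent in one component, which the choice of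
     [W] and the independence of [I] exclude for different blocks. *)
  apply: leq_trans cbad; apply/subset_leq_card/subsetP => u; rewrite in_set.
  case/andP=> /bigcupP[j neji uj] rvu; have [D DP uD] := coveredP _ _ uj.
  apply/bigcupP; exists D => //; rewrite inE DP /= /bad_pair.
  apply/andP; split; last first.
    by apply/negP => /no_edgesP/(_ v u vA uD); rewrite rvu.
  have := info _ _ _ vi AP vA; have := info _ _ _ uj DP uD.
  case: (boolP (has_hole r h A D)) => // nh; have eAD : e A D by apply/and3P.
  rewrite -(compP _ _ AP DP (connect1 eAD)).
  case: i j neji {vi uj} => [C|x] [C'|y] neij.
  + by move=> [C1 _ _] [C2 _ _]; rewrite C1 C2 eqxx in neij.
  + move=> [_ DI] [-> _ /negP[]]; apply/nbrsP; by exists D; rewrite // esym.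
  + move=> [-> _ /negP nD] [_ AI]; case: nD; apply/nbrsP; by exists A.
  + move=> [_ DI] [_ AI]; have [_ indI _ _] := HI (cls A) (imset_f _ AP).
    by have := indI A D AI DI; rewrite -/e eAD.
rewrite big_sumType /=.
have -> : \sum_C minn #|B (inl C)| a = \sum_(C in Q) minn #|W C| a.
  rewrite [RHS]big_mkcond; apply: eq_bigr => C _ /=.
  by case: ifP => // _; rewrite cards0 min0n.
(* The cap does not affect singletons because [0 < a]. *)
have -> : \sum_v minn #|B (inr v)| a = l * \sum_(C in Q) #|I C|.
  transitivity #|cover J|.
    rewrite -sum1_card [RHS]big_mkcond; apply: eq_bigr => v _ /=.
    by case: ifP => _; rewrite ?cards1 ?cards0 ?min0n //; apply/minn_idPl.
  rewrite (@card_cover_eq V J l); first last.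
  - by move=> A /JP[AP _ _]; apply: cP.
  - by apply: trivIsetS tP; apply/subsetP=> A /JP[].
  congr (l * _).
  pose F C := if C \in Q then I C else set0.
  have -> : J = \bigcup_C F C.
    by rewrite /J big_mkcond.
  rewrite -sum1_card (partition_disjoint_bigcup _ (fun=> 1)) /=.
    rewrite [RHS]big_mkcond; apply: eq_bigr => C _; rewrite sum1_card /F.
    by case: ifP => // _; rewrite cards0.
  move=> C C' neC; apply/pred0P => A; apply/negP => /andP[/=]; rewrite /F.
  case: ifP => [CQ|_]; last by rewrite inE.
  move=> AI; case: ifP => [CQ'|_]; last by rewrite inE.
  move=> AI'; have [IC _ _ _] := HI C CQ; have [IC' _ _ _] := HI C' CQ'.
  move: neC; rewrite (clsQ _ _ CQ (subsetP IC _ AI)).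
  by rewrite (clsQ _ _ CQ' (subsetP IC' _ AI')) eqxx.
rewrite big_distrr -big_split /=.
have an : a <= n' by apply: leq_trans an'; rewrite leq_pmull.
have clsA A : A \in P -> A \in cls A by move=> AP; rewrite inE AP connect0.
have tQ : \sum_(C in Q) #|C| = #|P|.
  symmetry; apply: (card_partition (P := Q)); apply/and3P; split.
  - apply/eqP/setP => A; apply/bigcupP/idP => [[C CQ]|AP].
      by apply/subsetP/QP.
    by exists (cls A); [apply: imset_f | apply: clsA].
  - apply/trivIsetP => C C' CQ CQ'.
    apply: contraNT => /pred0Pn[A /andP[/= CA CA']].
    by rewrite (clsQ _ _ CQ CA) (clsQ _ _ CQ' CA').
  - by apply/negP => /imsetP[A AP] /setP/(_ A); rewrite clsA // inE.
apply: (@sum_component_values _ Q (fun C => l * #|C|)) an hk _ _; last first.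
  by rewrite -big_distrr tQ.
move=> C CQ; have [IC indI caseI leI] := HI C CQ.
have NC : nbrs e (I C) \subset C :\: I C.
  apply/subsetP=> D /nbrsP[A AI eAD]; rewrite inE; apply/andP; split.
    by apply/negP => DI; have := indI A D AI DI; rewrite eAD.
  have AC' := subsetP IC _ AI; have /and3P[AP DP _] := eAD.
  by rewrite (clsQ _ _ CQ AC') (compP _ _ AP DP (connect1 eAD)) clsA.
have cIC : #|C :\: I C| = #|C| - #|I C| by rewrite cardsD (setIidPr IC).
have -> : #|W C| = l * (#|C| - #|I C| - #|nbrs e (I C)|).
  rewrite /W (@card_cover_eq V _ l).
  - by rewrite cardsD (setIidPr NC) cIC.
  - apply: trivIsetS tP; do 2![apply: subset_trans (subsetDl _ _) _].
    exact: QP.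
  - move=> A; rewrite !in_setD => /and3P[_ _ /(subsetP (QP _ CQ))]; exact: cP.
apply: (@arith_component l (l - 12 * h) _ _ _ n) => //.
- have := subset_leq_card NC; rewrite cIC => leN.
  by rewrite -(subnKC (subset_leq_card IC)) leq_add2l.
- case: caseI => [I0|]; [left | by right].
  rewrite I0 cards0; split=> //; apply/eqP; rewrite cards_eq0.
  by apply/eqP/setP => D; rewrite in_set0; apply/nbrsP => -[A]; rewrite inE.
- exact: leq_subr.
- exact: hn'.
Qed.

(** * Packing and embedding *)

(** One block of weight at least [A] suffices, and the cap lets it count at most [2 * A]. If all
    blocks are lighter than [A], removing them one by one cannot jump from above [2 * A] to below
    [A]. *)
Lemma select_blocks (K : finType) (w : K -> nat) (A a : nat) (J : {set K}) :
  a <= A -> a <= \sum_(j in J) minn (w j) (2 * A) ->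
  exists J1 : {set K}, [/\ J1 \subset J, a <= \sum_(j in J1) w j
    & \sum_(j in J1) minn (w j) (2 * A) <= 2 * A].
Proof.
move=> aA; have [m] := ubnP #|J|; elim: m J => // m IH J /ltnSE leJ aJ.
have [/exists_inP[j jJ Aj]|/exists_inPn small] :=
    boolP [exists j in J, A <= w j].
  exists [set j]; rewrite sub1set jJ !big_set1; split=> //.
  - exact: leq_trans Aj.
  - exact: geq_minr.
have [leS|ltS] := leqP (\sum_(j in J) minn (w j) (2 * A)) (2 * A).
  exists J; split=> //; apply: leq_trans aJ _; apply: leq_sum => j _.
  exact: geq_minl.
have [J0|/set0Pn[j jJ]] := eqVneq J set0; first by rewrite J0 big_set0 in ltS.
have [||J1 [J1J aJ1 leJ1]] := IH (J :\ j).
- by have := cardsD1 j J; rewrite jJ; move: leJ; clear; lia.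
- move: ltS; rewrite (big_setD1 j) //=; have := small j jJ; rewrite -ltnNge.
  by move: (\sum_(_ in _) _) aA; clear; lia.
by exists J1; split=> //; apply: subset_trans J1J _; apply: subsetDl.
Qed.

(** The colours from [k] down to 1 are served in turn, each using up at most [2 * A] of the capped
    weight; colour 0 receives all that is left, so it needs only its own demand. *)
Lemma pack_blocks (K : finType) (w : K -> nat) (A k : nat) (dem : nat -> nat)
    (J : {set K}) :
  (forall c, c <= k -> dem c <= A) ->
  k * (2 * A) + dem 0 <= \sum_(j in J) minn (w j) (2 * A) ->
  exists f : K -> nat, forall c, c <= k ->
    dem c <= \sum_(j in J | f j == c) w j.
Proof.
elim: k J => [|k IH] J leA leS.
  exists (fun=> 0) => c; rewrite leqn0 => /eqP->.
  apply: leq_trans leS _.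
  rewrite [leqRHS](eq_bigl (mem J)) => [|j]; last by rewrite /= andbT.
  by apply: leq_sum => j _; apply: geq_minl.
have [||J1 [J1J demJ1 leJ1]] := @select_blocks K w A (dem k.+1) J.
- exact: leA.
- apply: leq_trans leS; rewrite (leq_trans (leA _ (leqnn _))) // mulSn.
  by rewrite -addnA mul2n -addnn -addnA leq_addr.
have [c ck||f Hf] := IH (J :\: J1).
- by apply: leA; apply: leqW.
- move: leS; rewrite (big_setID J1) (setIidPr J1J) mulSn; move: leJ1.
  rewrite -addnA => le1 leS.
  by rewrite -(leq_add2l (2 * A)) (leq_trans leS) // leq_add2r.
exists (fun j => if j \in J1 then k.+1 else f j) => c; rewrite leq_eqVlt.
case/orP=> [/eqP->|]; last rewrite ltnS => ck.
  apply: leq_trans demJ1 _; rewrite big_mkcond [leqRHS]big_mkcond.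
  apply: leq_sum => j _; case: (boolP (j \in J1)) => // jJ1.
  by rewrite (subsetP J1J) // eqxx.
apply: leq_trans (Hf c ck) _; rewrite big_mkcond [leqRHS]big_mkcond.
apply: leq_sum => j _; rewrite !inE; by case: (j \in J1).
Qed.

Lemma card_bigcup_leq (I V : finType) (A : {set I}) (F : I -> {set V}) :
  #|\bigcup_(i in A) F i| <= \sum_(i in A) #|F i|.
Proof.
apply: (big_ind2 (fun (B : {set V}) m => #|B| <= m)) => // [|B b C c Bb Cc].
  by rewrite cards0.
by apply: leq_trans (leq_card_setU _ _) _; rewrite leq_add.
Qed.

Lemma degree_leq (T : finType) (G : sgraph T) (x : T) :
  #|[set y | G x y]| <= max_degree G.
Proof. exact: (leq_bigmax (F := fun x => #|[set y | G x y]|)). Qed.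

(** Vertices are placed one by one. Inside the set of its colour, a new vertex must avoid the images
    of the vertices already placed there, fewer than its class has, and at most [eps] red neighbours
    for each of its at most [Delta] neighbours. *)
Lemma greedy_embedding (T : finType) (G : sgraph T) (V : finType) (r : rel V)
    (col : T -> nat) (U : nat -> {set V}) (Delta eps : nat) :
  symmetric r -> max_degree G <= Delta ->
  (forall x y, G x y -> col x != col y) ->
  (forall c d, c != d -> [disjoint U c & U d]) ->
  (forall x y v, G x y -> v \in U (col x) ->
     #|[set u in U (col y) | r v u]| <= eps) ->
  (forall x, #|[set y | col y == col x]| + Delta * eps <= #|U (col x)|) ->
  exists f : T -> V, injective f /\ forall x y, G x y -> ~~ r (f x) (f y).
Proof.
move=> rsym degG colG disjU degU cardU.
(* [f] is total: vertices outside [s] have provisional images in the right set, so that [degU]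
   applies to all neighbours alike. *)
suff H (s : seq T) : uniq s -> exists f : T -> V,
    [/\ forall x, f x \in U (col x), {in s &, injective f}
      & {in s &, forall x y, G x y -> ~~ r (f x) (f y)}].
  have [f [_ injf Gf]] := H (enum T) (enum_uniq T).
  exists f; split=> [x y|x y]; first by apply: injf; rewrite mem_enum.
  by apply: Gf; rewrite mem_enum.
elim: s => [_|x s IH /= /andP[xs us]].
  have : forall x, exists v, v \in U (col x).
    move=> x; apply/set0Pn; rewrite -card_gt0.
    apply: leq_trans (cardU x); rewrite addn_gt0 card_gt0; apply/orP; left.
    by apply/set0Pn; exists x; rewrite inE.
  by case/fin_all_exists => f Hf; exists f; split.
have [f [fU injf Gf]] := IH us.
pose F1 := f @: [set y in s | col y == col x].
pose F2 := \bigcup_(y in [set y | G x y]) [set u in U (col x) | r (f y) u].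
have cF1 : #|F1| < #|[set y | col y == col x]|.
  apply: leq_ltn_trans (leq_imset_card _ _) _; apply/proper_card/properP; split.
    by apply/subsetP=> y; rewrite !inE => /andP[].
  by exists x; rewrite inE ?eqxx // (negPf xs).
have cF2 : #|F2| <= Delta * eps.
  apply: leq_trans (card_bigcup_leq _ _) _.
  apply: leq_trans (_ : \sum_(y in [set y | G x y]) eps <= _).
    apply: leq_sum => y; rewrite inE => Gxy.
    by apply: degU; rewrite // adj_sym.
  by rewrite sum_nat_const leq_mul2r (leq_trans (degree_leq _ _)) ?orbT.
have [v vU] : exists v, v \in U (col x) :\: (F1 :|: F2).
  apply/set0Pn; rewrite -card_gt0 cardsD subn_gt0.
  apply: leq_ltn_trans (subset_leq_card (subsetIr _ _)) _.
  apply: leq_ltn_trans (leq_card_setU _ _) _.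
  by apply: leq_trans (cardU x); rewrite -addSn leq_add.
move: vU; rewrite in_setD in_setU negb_or => /andP[/andP[vF1 vF2] vU].
have fv y : y \in s -> f y != v.
  move=> ys; have [cyx|ncyx] := eqVneq (col y) (col x).
    by apply: contraNneq vF1 => <-; apply: imset_f; rewrite inE ys cyx eqxx.
  have /pred0P/(_ v) /= := disjU _ _ ncyx; rewrite vU andbT.
  by apply: contraFneq => <-.
have rv y : G x y -> ~~ r (f y) v.
  move=> Gxy; apply: contra vF2 => ryv; apply/bigcupP; exists y; rewrite inE //.
  by rewrite vU.
have nx y : y \in s -> (y == x) = false.
  by move=> ys; apply: contraNF xs => /eqP<-.
exists (fun z => if z == x then v else f z); split.
- by move=> z; case: eqP => [->|].
- move=> z w; rewrite !inE => /orP[/eqP->|zs] /orP[/eqP->|ws]; rewrite ?eqxx //.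
  + by rewrite nx // => E; have := fv w ws; rewrite -E eqxx.
  + by rewrite nx // => E; have := fv z zs; rewrite E eqxx.
  + by rewrite !nx //; apply: injf.
- move=> z w; rewrite !inE => /orP[/eqP->|zs] /orP[/eqP->|ws]; rewrite ?eqxx.
  + by rewrite adj_irrefl.
  + by rewrite nx // rsym; apply: rv.
  + by rewrite nx // adj_sym => Gxz; rewrite rv.
  + by rewrite !nx //; apply: Gf.
Qed.

(** * Colourings and the bounds on the Ramsey number *)

Lemma bigminn_leq (I : finType) (Q : pred I) (F : I -> nat) (d : nat) (j : I) :
  Q j -> \big[minn/d]_(i | Q i) F i <= F j.
Proof.
move=> Qj; rewrite unlock; have := mem_index_enum j.
elim: (index_enum I) => //= i s IH; rewrite inE => /orP[/eqP<-|/IH le].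
  by rewrite Qj geq_minl.
by case: ifP => // _; apply: leq_trans (geq_minr _ _) le.
Qed.

(** No value exceeds the default [d], so a minimum equal to [d] is also the value at [j]. *)
Lemma bigminn_attained (I : finType) (Q : pred I) (F : I -> nat) (d : nat)
    (j : I) :
  Q j -> (forall i, Q i -> F i <= d) ->
  exists2 i, Q i & \big[minn/d]_(i | Q i) F i = F i.
Proof.
move=> Qj Fd; have [E|//] : \big[minn/d]_(i | Q i) F i = d \/
    exists2 i, Q i & \big[minn/d]_(i | Q i) F i = F i.
  apply: (big_ind (fun m => m = d \/ exists2 i, Q i & m = F i)).
  - by left.
  - by move=> m1 m2 H1 H2; rewrite /minn; case: ifP.
  - by move=> i Qi; right; exists i.
exists j => //; apply/eqP; rewrite eqn_leq bigminn_leq // E; exact: Fd.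
Qed.

Section GraphFacts.
Variables (T : finType) (G : sgraph T).
Local Notation chi := (chromatic_number G).

Lemma proper_coloringP (k : nat) (f : {ffun T -> 'I_k}) :
  reflect (forall x y, G x y -> f x != f y) (Defs.proper G f).
Proof.
apply: (iffP forallP) => [H x y Gxy|H x]; last first.
  by apply/forallP => y; apply/implyP; apply: H.
by have /forallP/(_ y)/implyP := H x; apply.
Qed.

(** Greedy colouring; it keeps the number of colour classes bounded while [n] grows. *)
Lemma chromatic_number_greedy : chi <= (max_degree G).+1.
Proof.
rewrite /chromatic_number; case: ex_minnP => k _; apply.
suff H (s : seq T) : uniq s -> exists f : T -> 'I_(max_degree G).+1,
    {in s &, forall x y, G x y -> f x != f y}.
  have [f Hf] := H (enum T) (enum_uniq T).
  apply/existsP; exists [ffun x => f x].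
  apply/proper_coloringP => x y; rewrite !ffunE.
  by apply: Hf; rewrite mem_enum.
elim: s => [_|x s IH /= /andP[xs us]]; first by exists (fun=> ord0).
have [f Hf] := IH us.
have [c] : exists c, c \notin f @: [set y | G x y].
  apply/existsP; rewrite -negb_forall; apply/negP => /forallP all_in.
  have : #|'I_(max_degree G).+1| <= #|f @: [set y | G x y]|.
    by apply/subset_leq_card/subsetP => c _; apply: all_in.
  rewrite card_ord leqNgt ltnS (leq_trans (leq_imset_card _ _)) //.
  exact: degree_leq.
move=> cN; have cNy y : G x y -> f y != c.
  by move=> Gxy; apply: contraNneq cN => <-; apply: imset_f; rewrite inE.
exists (fun z => if z == x then c else f z) => z w; rewrite !inE.
have nx y : y \in s -> (y == x) = false.
  by move=> ys; apply: contraNF xs => /eqP<-.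
move=> /orP[/eqP->|zs] /orP[/eqP->|ws]; rewrite ?eqxx ?nx //.
- by rewrite adj_irrefl.
- by rewrite eq_sym; apply: cNy.
- by rewrite adj_sym; apply: cNy.
- exact: Hf.
Qed.

Lemma chromatic_colorable : colorable G chi.
Proof. by rewrite /chromatic_number; case: ex_minnP. Qed.

Lemma chromatic_gt0 : 0 < #|T| -> 0 < chi.
Proof.
case/card_gt0P => x _; have /existsP[f _] := chromatic_colorable.
exact: leq_ltn_trans (ltn_ord (f x)).
Qed.

(** The colour of an empty class could be skipped, giving a proper colouring with fewer than [chi]
    colours. *)
Lemma color_class_gt0 (k : nat) (f : {ffun T -> 'I_k}) (i : 'I_k) :
  k <= chi -> Defs.proper G f -> 0 < #|[set x | f x == i]|.
Proof.
case: k f i => [_ []//|k] f i kchi /proper_coloringP pf.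
rewrite card_gt0; apply: contraTneq kchi => class0; rewrite -ltnNge.
have : forall x, exists j, f x = lift i j.
  move=> x; have : x \notin [set x | f x == i] by rewrite class0 inE.
  by rewrite inE eq_sym => /unlift_some[j -> _]; exists j.
case/fin_all_exists => g fg.
rewrite ltnS /chromatic_number; case: ex_minnP => m _; apply.
apply/existsP; exists [ffun x => g x]; apply/proper_coloringP => x y /pf.
by rewrite !ffunE !fg; apply: contraNneq => ->.
Qed.

Lemma min_color_class_leq (f : {ffun T -> 'I_chi}) (i : 'I_chi) :
  Defs.proper G f -> min_color_class G <= #|[set x | f x == i]|.
Proof.
move=> pf; rewrite /min_color_class.
apply: leq_trans (bigminn_leq _ _ pf) _.
exact: (@bigminn_leq _ predT (fun j => #|[set x | f x == j]|) _ i).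
Qed.

Lemma min_color_class_attained : 0 < #|T| ->
  exists (f : {ffun T -> 'I_chi}) (i : 'I_chi),
    Defs.proper G f /\ #|[set x | f x == i]| = min_color_class G.
Proof.
move=> T0; have chi0 := chromatic_gt0 T0.
have /existsP[f0 pf0] := chromatic_colorable.
have inner (f : {ffun T -> 'I_chi}) : exists2 i, true &
    \big[minn/#|T|]_(i < chi) #|[set x | f x == i]| = #|[set x | f x == i]|.
  apply: (@bigminn_attained _ predT (fun i => #|[set x | f x == i]|) _
    (Ordinal chi0)) => // i _.
  exact: max_card.
have [|f pf E] := @bigminn_attained _ (fun f => Defs.proper G f)
  (fun f : {ffun T -> 'I_chi} =>
  \big[minn/#|T|]_(i < chi) #|[set x | f x == i]|) #|T| f0 pf0.
  by move=> f _; have [i _ ->] := inner f; apply: max_card.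
have [i _ Ei] := inner f; exists f, i; split=> //.
by rewrite /min_color_class E Ei.
Qed.

Lemma independent_leq (A : {set T}) :
  {in A &, forall x y, ~~ G x y} -> #|A| <= independence_number G.
Proof.
move=> indA; apply: (leq_bigmax_cond (F := fun A : {set T} => #|A|)).
by apply/forall_inP => x xA; apply/forall_inP => y; apply: indA.
Qed.

Lemma min_color_class_independence : 0 < #|T| ->
  0 < min_color_class G <= independence_number G.
Proof.
move=> T0; have [f [i [pf <-]]] := min_color_class_attained T0.
rewrite color_class_gt0 //; apply: independent_leq => x y.
rewrite !inE => /eqP fx /eqP fy; apply/negP => Gxy.
by move/proper_coloringP/(_ x y Gxy): pf; rewrite fx fy eqxx.
Qed.

Lemma optimal_coloring : 0 < #|T| ->
  exists col : T -> nat, [/\ forall x y, G x y -> col x != col y,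
    forall x, col x < chi & #|[set x | col x == 0]| = min_color_class G].
Proof.
move=> T0.
have [f [i [/proper_coloringP pf <-]]] := min_color_class_attained T0.
have chi0 := chromatic_gt0 T0; pose o := Ordinal chi0.
(* The transposition renames the colour of a smallest class to 0, the colour that packing serves
   last. *)
exists (fun x => tperm i o (f x) : 'I_chi); split=> [x y /pf|//|].
  by rewrite (inj_eq val_inj) (inj_eq perm_inj).
apply: eq_card => x; rewrite !inE -[0]/(val o) (inj_eq val_inj).
by rewrite -[X in _ == X](tpermL i o) (inj_eq perm_inj).
Qed.

End GraphFacts.

(** * The lower bound *)

Lemma arrows_path_lower (T : finType) (G : sgraph T) (n N : nat) :
  #|T| = n -> 1 < n -> independence_number G < n ->
  arrows (path_graph n) G N ->
  (chromatic_number G).-1 * n.-1 + min_color_class G <= N.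
Proof.
move=> cT n1 alphan arr; have T0 : 0 < #|T| by rewrite cT ltnW.
have [sg0 sga] := andP (min_color_class_independence G T0).
have chi0 := chromatic_gt0 G T0.
have m0 : 0 < n.-1 by rewrite -subn1 subn_gt0.
set chi := chromatic_number G in chi0 *.
set sg := min_color_class G in sg0 sga *.
rewrite leqNgt; apply/negP => ltN.
(* Consecutive intervals of length [n - 1] are the red cliques; as [sg < n], the fewer than [sg]
   vertices beyond the first [chi - 1] intervals fit into one more. *)
pose blk (v : 'I_N) := v %/ n.-1.
pose c := [ffun S : {set 'I_N} =>
  [forall x in S, forall y in S, blk x == blk y]].
have cE x y : c [set x; y] = (blk x == blk y).
  rewrite ffunE; apply/forall_inP/eqP => [H|H z].
    by have /forall_inP/(_ y) := H x (set21 x y); rewrite set22 => /(_ isT)/eqP.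
  rewrite !inE => /orP[]/eqP->; apply/forall_inP => w; rewrite !inE;
  by case/orP => /eqP->; rewrite ?H.
have /forallP/(_ c)/orP[] := arr.
  case/existsP => f /andP[/injectiveP injf /forallP pathf].
  (* A red path stays in one block, so residues modulo [n - 1] would have to tell its [n] vertices
     apart. *)
  have blkf (i : 'I_n) : blk (f i) = blk (f (Ordinal (ltnW n1))).
    case: i; elim => [|i IH] lti; first by congr (blk (f _)); apply: val_inj.
    rewrite -(IH (ltnW lti)).
    have /forallP/(_ (Ordinal lti)) := pathf (Ordinal (ltnW lti)).
    by rewrite /= /path_rel /= eqxx /= cE => /eqP/eqP.
  have : injective (fun i : 'I_n => Ordinal (ltn_pmod (f i) m0)).
    move=> i j /(congr1 val) /= eqm; apply/injf/val_inj => /=.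
    by rewrite (divn_eq (f i) n.-1) (divn_eq (f j) n.-1) eqm;
      congr (_ * _ + _); exact: etrans (blkf i) (esym (blkf j)).
  move/leq_card; rewrite !card_ord leqNgt prednK ?leqnn // ltnW //.
case/existsP => f /andP[/injectiveP injf /forallP Gf].
(* On a blue copy the block index is a proper colouring of [G] with [chi] colours, so its last class
   has at least [sg] vertices, more than the last block can hold. *)
have ltblk v : blk v < chi.
  rewrite ltn_divLR // (leq_trans (ltn_ord v)) // (leq_trans (ltnW ltN)) //.
  rewrite -{2}(prednK chi0) mulSnr leq_add2l.
  by rewrite -ltnS prednK ?(ltnW n1) // (leq_ltn_trans sga).
pose col := [ffun x => Ordinal (ltblk (f x))].
have pcol : Defs.proper G col.
  apply/proper_coloringP => x y Gxy; rewrite !ffunE -val_eqE /=.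
  by have /forallP/(_ y) := Gf x; rewrite Gxy cE /= => /eqP->.
have ltlast : chi.-1 < chi by rewrite prednK.
have := min_color_class_leq (Ordinal ltlast) pcol.
have := color_class_gt0 (Ordinal ltlast) (leqnn _) pcol.
rewrite -/sg; set cls := [set x | _].
pose low := chi.-1 * n.-1.
have clsf x : x \in cls -> low <= f x.
  rewrite inE ffunE -val_eqE /= => /eqP E.
  by rewrite /low -E /blk leq_divM.
have : #|cls| <= N - low.
  have [->|/card_gt0P[x0 x0c]] := posnP #|cls|; first by [].
  have lowN : 0 < N - low by rewrite subn_gt0 (leq_ltn_trans (clsf _ x0c)).
  have fm x : x \in cls -> f x - low < N - low.
    by move=> xc; rewrite ltn_sub2rE ?clsf.
  rewrite -[N - low]card_ord -(prednK lowN).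
  pose g x : 'I_(N - low).-1.+1 := inord (f x - low).
  rewrite -(card_in_imset (f := g)).
    exact: max_card.
  move=> x y xc yc /(congr1 val); rewrite /= !inordK ?prednK ?fm // => E.
  apply/injf/val_inj; rewrite /= -(subnKC (clsf _ xc)) E subnKC //; exact: clsf.
move: ltN; rewrite -/low; clear; lia.
Qed.

(** * The upper bound: choice of parameters and assembly *)

Lemma clean_partition (p g K : nat) (V : finType) (r : rel V)
    (P : {set {set V}}) (l : nat) :
  1 < p -> 0 < #|V| -> regular_partition r g (p ^ 2) K l P ->
  exists P1 : {set {set V}},
    [/\ trivIset P1, forall A, A \in P1 -> #|A| = l, #|P1| <= K,
        #|V| <= 2 * (l * K)
      & #|V| <= l * #|P1| + 2 * (#|V| %/ p) + 2 /\
        forall A, A \in P1 ->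
          #|[set B in P1 | bad_pair r (l %/ g) A B]| * l <= #|V| %/ p].
Proof.
move=> p1 V0 [tP cP /andP[P0 PK] covP badP].
have p0 : 0 < p by apply: ltnW.
have cov := card_cover_eq tP cP.
pose bad A := [set B in P | bad_pair r (l %/ g) A B].
(* Clusters in more than [#|P| / p] bad pairs are dropped; as at most a share [1 / p ^ 2] of all
   pairs is bad, at most [#|P| / p] clusters go. *)
pose P1 := [set A in P | p * #|bad A| <= #|P|].
have P1P : P1 \subset P by apply/subsetP=> A; rewrite inE => /andP[].
have covV : l * #|P| <= #|V| by rewrite -cov max_card.
have le2 : p * #|V| <= p * (l * #|P|) + #|V|.
  rewrite -cov -(leq_pmul2l p0); move: covP; rewrite -mulnn.
  have : #|V| <= p * #|V| by rewrite leq_pmull.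
  by move: #|cover P| #|V|; clear; nia.
have dropP : p * #|P :\: P1| <= #|P|.
  have : #|P :\: P1| * #|P| <= p * #|bad_pairs r (l %/ g) P|.
    have -> : #|bad_pairs r (l %/ g) P| = \sum_(A in P) #|bad A|.
      rewrite -sum1_card (eq_bigr (fun A => \sum_(B in bad A) 1)) => [|A _];
        last by rewrite sum1_card.
      rewrite pair_big_dep; apply: eq_bigl => -[A B] /=.
      by rewrite !inE /= andbA.
    rewrite (big_setID P1) /= mulnDr (setIidPr P1P).
    apply: leq_trans (leq_addl _ _); rewrite big_distrr -sum_nat_const /=.
    apply: leq_sum => A; rewrite !inE => /andP[+ AP].
    by rewrite AP /= -ltnNge => /ltnW.
  move=> le3; rewrite -(leq_pmul2r P0) mulnn; apply: leq_trans badP.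
  by rewrite -mulnn -!mulnA leq_mul2l le3 orbT.
exists P1; split.
- exact: trivIsetS P1P tP.
- by move=> A /(subsetP P1P); apply: cP.
- exact: leq_trans (subset_leq_card P1P) PK.
- have : #|V| <= 2 * (l * #|P|).
    by move: le2 p1; move: (l * #|P|); clear; nia.
  by move/leq_trans; apply; rewrite !leq_mul.
split.
  have cPP1 : #|P :\: P1| + #|P1| = #|P|.
    by rewrite addnC -(cardsID P1 P) (setIidPr P1P).
  have le4 : p * (l * #|P :\: P1|) <= #|V|.
    by apply: leq_trans covV; rewrite mulnCA leq_mul2l dropP orbT.
  have le5 : l * #|P :\: P1| <= #|V| %/ p by rewrite leq_divRL // mulnC.
  have le6 : #|V| - l * #|P| <= #|V| %/ p.
    by rewrite leq_divRL // mulnC mulnBr leq_subLR.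
  by move: le5 le6; rewrite -cPP1 mulnDr; clear; lia.
move=> A; rewrite inE => /andP[AP badA]; rewrite leq_divRL // mulnC.
apply: leq_trans covV; rewrite mulnA mulnC leq_mul2l; apply/orP; right.
apply: leq_trans badA; rewrite leq_mul2l; apply/orP; right.
by apply/subset_leq_card/subsetP=> B; rewrite !inE => /andP[/andP[-> _] ->].
Qed.

(** [E] bounds the basic errors, [F] their multiples by factors up to [d.+1 ^ 2], and
    [100 * F <= n %/ q] lets the surplus absorb them. The fourth inequality has slack about [n / 4]:
    [a] and [b] are about [n / 2], and [sg] is at most [n / 4]. The bound [500 * d.+1 <= n] covers
    the rounding in [b]. *)
Lemma arith_parameters (d q n k np eps sg M : nat) :
  0 < q -> k <= d -> 
  let E := n %/ (100 * d.+1 ^ 2 * q) in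
  0 < E -> np <= E -> eps <= E -> 4 * sg <= n -> 500 * d.+1 <= n ->
  k * n + sg + n %/ q <= M + 2 * E + 2 ->
  let a := 2 * (n %/ 4 + d * eps) in
  let n' := n + np + 4 * (d * eps) in
  let b := (n - np - 4 * (d * eps))./2 - 2 in
  [/\ 2 * a <= n', b <= a, 2 * b + n' <= 2 * n,
      k * a + (sg + d * eps) <= k.+1 * b & k * n' + (sg + d * eps) <= M].
Proof.
move=> q0 kd E E0 npE epsE sgn nd leM a n' b.
pose F := d.+1 ^ 2 * E.
have FE : d.+1 * E <= F by rewrite /F leq_mul2r leq_pmull ?orbT.
have EF : E <= F by apply: leq_trans FE; rewrite leq_pmull.
have qF : q * (100 * F) <= n.
  apply: leq_trans (leq_divM n (100 * d.+1 ^ 2 * q)).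
  by rewrite -/E /F; move: (d.+1 ^ 2); clear; lia.
have F100 : 100 * F <= n %/ q by rewrite leq_divRL // mulnC.
have F100n : 100 * F <= n by apply: leq_trans F100 (leq_div _ _).
have deps : d * eps <= F.
  by apply: leq_trans FE; rewrite leq_mul // leqnSn.
have kE : k.+1 * np <= F by apply: leq_trans FE; rewrite leq_mul.
have kdE : k.+1 * (d * eps) <= F.
  by rewrite /F -mulnn -mulnA leq_mul // leq_mul // leqnSn.
have np_n : np + 4 * (d * eps) <= n.
  by move: npE EF deps F100n; clear; lia.
have n4 : 4 * (n %/ 4) <= n by rewrite mulnC leq_divM.
have b2 : n <= 2 * b + np + 4 * (d * eps) + 5.
  by rewrite /b; move: np_n; clear; lia.
split.
- by rewrite /a /n'; move: n4; clear; lia.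
- by rewrite /a /b; clear; lia.
- by rewrite /b /n'; move: np_n; clear; lia.
- have := leq_mul (leqnn k.+1) b2; have := leq_mul (leqnn k) n4.
  move: kE kdE deps F100n nd sgn kd; rewrite /a; clearbody F b; clear; lia.
- move: leM kE kdE F100 EF E0; rewrite /n'; clearbody F E; clear; lia.
Qed.

Lemma blocks_without_long_path (d q : nat) : 0 < q ->
  exists n0, forall (n k sg : nat) (V : finType) (r : rel V),
    n0 <= n -> k <= d -> 4 * sg <= n -> symmetric r ->
    #|V| = k * n + sg + n %/ q ->
    (forall s, sorted r s -> uniq s -> size s < n) ->
    exists (K : finType) (B : K -> {set V}) (eps : nat),
      [/\ forall i j, i != j -> [disjoint B i & B j],
          forall i v, v \in B i ->
            #|[set u in \bigcup_(j | j != i) B j | r v u]| <= eps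
        & let A := n %/ 4 + d * eps in
          k * (2 * A) + (sg + d * eps) <= \sum_i minn #|B i| (2 * A)].
Proof.
(* [u] is the divisor in the error bound [E]; the factor [d.+2] in [p] compensates for
   [#|V| <= d.+2 * n]. *)
move=> q0; pose u := 100 * d.+1 ^ 2 * q; pose p := d.+2 * u.
have u0 : 1 < u.
  rewrite /u -mulnA; apply: (@leq_trans (100 * 1)) => //.
  by rewrite leq_mul2l muln_gt0 expn_gt0.
have p1 : 1 < p by rewrite /p (leq_trans u0) // leq_pmull.
have p0 := ltnW p1.
(* With [h = l %/ g], the loss [12 * h] per cluster is at most a share [1 / p] of the remaining
   [l - 12 * h] vertices. *)
pose g := 12 + 12 * p.
have p20 : 0 < p ^ 2 by rewrite expn_gt0 p0.
have [K [N0 regP]] := @hole_regularity g (p ^ 2) isT p20.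
(* The first summand makes [V] large enough for regularity and for clusters with [K ^ 2 < h]; [u]
   makes [E] positive, and [500 * d.+1] covers rounding. *)
exists (q * (N0 + 2 * (g * (K ^ 2).+1 * K) + 1) + u + 500 * d.+1).
move=> n k sg V r ln kd sgn rsym cV short.
have nu : u <= n by move: ln; clear; lia.
have nd : 500 * d.+1 <= n by move: ln; clear; lia.
have leN : N0 + 2 * (g * (K ^ 2).+1 * K) + 1 <= #|V|.
  rewrite cV; apply: leq_trans (leq_addl _ _); rewrite leq_divRL // mulnC.
  by move: ln; clear; lia.
have V0 : 0 < #|V| by move: leN; clear; lia.
have [|P0 [l regP0]] := regP V r; first by move: leN; clear; lia.
have [P [tP cP cPK VlK [VM badP]]] := clean_partition p1 V0 regP0.
have K0 : 0 < K by move: V0 VlK; case: (K) => //; rewrite !muln0; case: #|V|.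
set h := l %/ g in badP *.
have lK : g * (K ^ 2).+1 <= l.
  rewrite -(leq_pmul2r K0) -(@leq_pmul2l 2) //.
  by move: leN VlK; clear; lia.
have hK : (K ^ 2).+1 <= h by rewrite leq_divRL // mulnC.
have gh : 12 * h + p * (12 * h) <= l.
  have := leq_divM l g; rewrite -/h /g; clear; lia.
have h0 : 0 < h by apply: leq_trans hK.
have hl : 12 * h < l.
  apply: leq_trans gh; rewrite -addn1 leq_add2l muln_gt0 p0 /=.
  by rewrite muln_gt0.
pose E := n %/ u; pose np := n %/ p; pose eps := #|V| %/ p.
have VC : #|V| <= d.+2 * n.
  rewrite cV; have : k * n <= d * n by rewrite leq_mul.
  by have := leq_div n q; move: sgn; clear; lia.
have epsE : eps <= E.
  by rewrite /eps /E (leq_trans (leq_div2r p VC)) // /p divnMl.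
have npE : np <= E.
  rewrite /np /E -[leqRHS](@divnMl d.+2) // -/p.
  by rewrite leq_div2r // leq_pmull.
have E0 : 0 < E by rewrite divn_gt0 // ltnW.
have leM : k * n + sg + n %/ q <= l * #|P| + 2 * E + 2.
  by rewrite -cV; move: VM epsE; rewrite -/eps; clear; lia.
have [an' ba bn hk hM] := arith_parameters q0 kd E0 npE epsE sgn nd leM.
have a0 : 0 < 2 * (n %/ 4 + d * eps) by move: nd; clear; lia.
have hP : #|P| ^ 2 <= h.
  by apply: leq_trans (ltnW hK); rewrite leq_sqr.
have hn' x : x * (l - 12 * h) <= n -> x * l <= n + np + 4 * (d * eps).
  move=> xn; have : x * (12 * h) <= np.
    rewrite leq_divRL // mulnC mulnCA (leq_trans _ xn) // leq_mul2l.
    by apply/orP; right; move: gh; clear; lia.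
  move: xn; rewrite mulnBr.
  by move: (x * l) (x * _) (d * eps); clear; lia.
have [K' [B [disjB degB sumB]]] := blocks_of_components rsym tP cP hP h0 hl
  short badP hn' a0 an' ba bn hk hM.
by exists K', B, eps; split.
Qed.

Lemma card_bigcup_disjoint (I V : finType) (Q : pred I) (B : I -> {set V}) :
  (forall i j, i != j -> [disjoint B i & B j]) ->
  #|\bigcup_(i | Q i) B i| = \sum_(i | Q i) #|B i|.
Proof.
move=> disjB; pose F i := if Q i then B i else set0.
have -> : \bigcup_(i | Q i) B i = \bigcup_i F i by rewrite big_mkcond.
rewrite -sum1_card (partition_disjoint_bigcup _ (fun=> 1)) /=; last first.
  move=> i j /disjB; rewrite /F; case: (Q i); case: (Q j) => // _;
  by rewrite -setI_eq0 ?setI0 ?set0I.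
rewrite [RHS]big_mkcond; apply: eq_bigr => i _; rewrite sum1_card /F.
by case: ifP => // _; rewrite cards0.
Qed.

Lemma red_path_copy (n N : nat) (c : {ffun {set 'I_N} -> bool}) (s : seq 'I_N) :
  sorted (fun x y => (x != y) && c [set x; y]) s -> uniq s -> n <= size s ->
  mono_copy c true (path_graph n).
Proof.
case: s => [|x0 s] ss us ns.
  apply/existsP; case: n ns => // _.
  exists [ffun i : 'I_0 => False_rect _ (notF (ltn_ord i))].
  by apply/andP; split; [apply/injectiveP => -[] | apply/forallP => -[]].
set t := x0 :: s in ss us ns.
have nt (i : 'I_n) : i < size t by apply: leq_trans ns.
apply/existsP; exists [ffun i : 'I_n => nth x0 t i]; apply/andP; split.
  apply/injectiveP => i j; rewrite !ffunE => /eqP.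
  by rewrite nth_uniq // => /eqP/val_inj.
have cS (i j : 'I_n) : i.+1 == j -> c [set nth x0 t i; nth x0 t j].
  move=> /eqP ij; move/(sortedP x0)/(_ i): ss; rewrite ij => /(_ (nt j)).
  by case/andP.
apply/forallP => i; apply/forallP => j; apply/implyP; rewrite !ffunE.
case/orP=> [/cS->//|/cS]; by rewrite setUC => ->.
Qed.

Lemma arrows_path_upper (d q : nat) : 0 < q ->
  exists n0, forall (n : nat) (T : finType) (G : sgraph T),
    n0 <= n -> #|T| = n -> max_degree G <= d ->
    4 * independence_number G <= n ->
    arrows (path_graph n) G
      ((chromatic_number G).-1 * n + min_color_class G + n %/ q).
Proof.
move=> q0; have [n0 H] := blocks_without_long_path d q0.
exists n0.+1 => n T G ln cT degG alphaG.
have T0 : 0 < #|T| by rewrite cT (leq_trans _ ln).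
set chi := chromatic_number G; set sg := min_color_class G.
have chi0 : 0 < chi by apply: chromatic_gt0.
have [_ sga] := andP (min_color_class_independence G T0).
set N := _ + _; apply/forallP => c.
(* [r] excludes loops, so a pair not related by [r] is blue only if its vertices differ; injectivity
   of the embedding supplies this at the end. *)
pose r (x y : 'I_N) := (x != y) && c [set x; y].
have rsym : symmetric r by move=> x y; rewrite /r eq_sym setUC.
have [|nopath] := boolP (mono_copy c true (path_graph n)); first by [].
have short s : sorted r s -> uniq s -> size s < n.
  move=> ss us; rewrite ltnNge; apply: contra nopath => ns.
  exact: red_path_copy ss us ns.
have kd : chi.-1 <= d.
  rewrite -ltnS prednK //; apply: leq_trans (chromatic_number_greedy G) _.
  by rewrite ltnS.
have sgn : 4 * sg <= n by apply: leq_trans alphaG; rewrite leq_mul2l.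
have [K [B [eps [disjB degB]]]] :=
  H n chi.-1 sg _ r (ltnW ln) kd sgn rsym (card_ord N) short.
set A := _ %/ 4 + _ => /= sumB.
have [col [colG colchi col0]] := optimal_coloring G T0.
(* The additional [d * eps] is the room that greedy embedding needs; the classes themselves are
   independent and so have at most [n / 4] vertices. *)
pose dem c := #|[set x | col x == c]| + d * eps.
have demA c' : c' <= chi.-1 -> dem c' <= A.
  move=> _; rewrite /dem /A leq_add2r leq_divRL // mulnC.
  apply: leq_trans alphaG; rewrite leq_mul2l; apply: independent_leq => x y.
  rewrite !inE => /eqP cx /eqP cy; apply/negP => /colG.
  by rewrite cx cy eqxx.
have [|f Hf] := @pack_blocks K (fun i => #|B i|) A chi.-1 dem setT demA.
  rewrite /dem col0; apply: leq_trans sumB _.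
  by rewrite [leqRHS](eq_bigl predT) // => i; rewrite inE.
pose U e := \bigcup_(i | f i == e) B i.
have [||||||g [injg Gg]] := @greedy_embedding T G _ r col U d eps.
- exact: rsym.
- exact: degG.
- exact: colG.
- move=> e e' nee; apply/pred0P => v; apply/negP => /andP[/=].
  case/bigcupP=> i /eqP fi vi /bigcupP[j /eqP fj vj].
  have nij : i != j by apply: contraNneq nee => ij; rewrite -fi -fj ij.
  by have /pred0P/(_ v) /= := disjB i j nij; rewrite vi vj.
- move=> x y v Gxy /bigcupP[i /eqP fi vi]; apply: leq_trans (degB i v vi).
  apply/subset_leq_card/subsetP => w; rewrite !inE.
  case/andP=> /bigcupP[j /eqP fj wj] ->.
  rewrite andbT; apply/bigcupP; exists j => //.
  by apply: contraNneq (colG x y Gxy) => ji; rewrite -fi -fj ji.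
- move=> x; apply: leq_trans (Hf (col x) _) _.
    by rewrite -ltnS prednK.
  rewrite card_bigcup_disjoint // (eq_bigl (fun i => f i == col x)) // => i.
  by rewrite inE.
apply/existsP; exists [ffun x => g x]; apply/andP; split.
  by apply/injectiveP => x y; rewrite !ffunE; apply: injg.
apply/forallP => x; apply/forallP => y; apply/implyP => Gxy; rewrite !ffunE.
have := Gg x y Gxy; rewrite /r negb_and negbK => /orP[/eqP/injg exy|].
  by rewrite exy adj_irrefl in Gxy.
by case: (c _).
Qed.

Lemma ramsey_path_bounds (Delta q : nat) : 0 < q ->
  exists n0, forall (n : nat) (T : finType) (G : sgraph T),
    n0 <= n -> #|T| = n -> max_degree G <= Delta ->
    4 * independence_number G <= n ->
    0 < chromatic_number G /\
    let m := (chromatic_number G).-1 * n + min_color_class G in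
    m <= ramsey (path_graph n) G + n %/ q /\
    ramsey (path_graph n) G <= m + n %/ q.
Proof.
move=> q0; have [n0 H] := arrows_path_upper Delta q0.
exists (n0 + q * Delta + 2) => n T G ln cT degG alphaG.
have n1 : 1 < n by move: ln; clear; lia.
have chi0 : 0 < chromatic_number G by apply: chromatic_gt0; rewrite cT ltnW.
have alphan : independence_number G < n by move: alphaG n1; clear; lia.
split=> // m; rewrite /ramsey; case: ex_minnP => N arrN minN; split; last first.
  by apply/minN/H => //; move: ln; clear; lia.
have := arrows_path_lower cT n1 alphan arrN.
(* The lower bound uses cliques of order [n - 1] instead of [n]; the difference [chi - 1 <= Delta]
   is at most [n %/ q] for large [n]. *)
have chiD : (chromatic_number G).-1 <= n %/ q.
  apply: (@leq_trans Delta).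
    by rewrite -ltnS prednK // (leq_trans (chromatic_number_greedy G)).
  by rewrite leq_divRL // mulnC; move: ln; clear; lia.
rewrite /m -{2}(prednK (ltnW n1)) mulnSr.
by move: chiD; move: (_ * _) (n %/ q); clear; lia.
Qed.

(** * The asymptotic statement over the reals *)

Import Order.TTheory GRing.Theory Num.Theory.
Local Open Scope ring_scope.

Theorem theorem1 (R : realType) (Delta : nat) (hDelta : (3 <= Delta)%N)
    (delta : R) (hdelta : 0 < delta) :
  exists n0 : nat, forall (n : nat) (T : finType) (G : sgraph T),
    (n0 <= n)%N ->
    #|T| = n ->
    (max_degree G <= Delta)%N ->
    (independence_number G)%:R <= n%:R / 4%:R :> R ->
    `| (ramsey (path_graph n) G)%:R
       - (((chromatic_number G)%:R - 1) * n%:R + (min_color_class G)%:R) |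
      <= delta * n%:R.
Proof.
(* This [q] exceeds [1 / delta], so [n %/ q] is at most [delta * n]. *)
pose q := (Num.truncn delta^-1).+1.
have [n0 H] := @ramsey_path_bounds Delta q isT.
exists n0 => n T G ln cT degG alphaG.
have alphaN : (4 * independence_number G <= n)%N.
  by rewrite -(ler_nat R) natrM mulrC -ler_pdivlMr ?ltr0n.
have [chi0 [le1 le2]] := H n T G ln cT degG alphaN.
have nq : (n %/ q)%:R <= delta * n%:R.
  apply: (@le_trans _ _ (n%:R / q%:R)).
    by rewrite ler_pdivlMr ?ltr0n // -natrM ler_nat leq_divM.
  rewrite mulrC ler_wpM2r ?ler0n // invf_ple ?posrE ?ltr0n //.
  exact/ltW/truncnS_gt.
(* By [chi0] the truncated predecessor agrees with subtraction in [R]. *)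
have -> : ((chromatic_number G)%:R - 1) * n%:R + (min_color_class G)%:R =
    ((chromatic_number G).-1 * n + min_color_class G)%:R :> R.
  by rewrite -{1}(prednK chi0) -addn1 natrD addrK natrD natrM.
apply: le_trans nq; rewrite ler_distl lerBlDr -!natrD !ler_nat.
by rewrite le1 le2.
Qed.
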